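(* The satisfiability problem for $H_\mu$ — given a closed $H_\mu$ formula $\varphi$, decide whether there is a non-empty set of traces $\mathcal{T}\subseteq(2^{\mathrm{AP}})^\omega$ with $\mathcal{T}\models\varphi$ — is $\Sigma^1_2$-hard.
   Context: Let $\mathrm{AP}$ be a finite set of atomic propositions; a trace is an element of $(2^{\mathrm{AP}})^\omega$. $H_\mu$ formulas: $\varphi::=\exists\pi.\varphi\mid\forall\pi.\varphi\mid\psi$, $\psi::=a_\pi\mid X\mid\bigcirc_\pi\psi\mid\psi\vee\psi\mid\neg\psi\mid\mu X.\psi$, with $X$ occurring in $\mu X.\psi$ only under an even number of negations; closed means all path variables and predicates are bound. Trace semantics w.r.t. a set of traces $\mathcal{T}$: for quantifier-free $\psi$ over $\pi_1,\dots,\pi_n$, a trace assignment $\Pi$ maps $\pi_i$ to traces in $\mathcal{T}$, a predicate valuation $\mathcal{V}$ maps predicates to functions from trace assignments to subsets of $\mathbb{N}_0^n$; $[\![a_{\pi_i}]\!]^{\mathcal{V}}(\Pi)=\{j\in\mathbb{N}_0^n:a\in\Pi(\pi_i)(j_i)\}$, $[\![X]\!]^{\mathcal{V}}=\mathcal{V}(X)$, $[\![\bigcirc_{\pi_i}\psi]\!]^{\mathcal{V}}(\Pi)=\{j:j+e_i\in[\![\psi]\!]^{\mathcal{V}}(\Pi)\}$, $\vee$ is union, $\neg$ is complement in $\mathbb{N}_0^n$, $[\![\mu X.\psi]\!]^{\mathcal{V}}$ is the least fixpoint of $\xi\mapsto[\![\psi]\!]^{\mathcal{V}[X\mapsto\xi]}$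 w.r.t. pointwise inclusion. $\Pi\models^{\mathcal{T}}\exists\pi.\varphi$ iff $\Pi[\pi\mapsto t]\models^{\mathcal{T}}\varphi$ for some $t\in\mathcal{T}$; $\forall$ dually; $\Pi\models^{\mathcal{T}}\psi$ iff $(0,\dots,0)\in[\![\psi]\!]^{\mathcal{V}}(\Pi)$ for some $\mathcal{V}$; $\mathcal{T}\models\varphi$ iff the empty assignment satisfies $\varphi$. A decision problem is $\Sigma^1_2$-hard if every $\Sigma^1_2$ set of natural numbers (definable in second-order arithmetic by $\exists X_1\dots\exists X_k\psi$ with $\psi\in\Pi^1_1$) is 1-reducible to it. *)

(* Defs.v *)
From Stdlib Require Cantor.
From mathcomp Require Import all_boot.
From mathcomp Require Import boolp classical_sets.

Set Implicit Arguments.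
Unset Strict Implicit.
Unset Printing Implicit Defensive.

Local Open Scope classical_set_scope.

Section Syntax.
Variables (AP : finType) (n : nat).

(* The path variables of a formula are pi_1, ..., pi_n, represented by 'I_n;
   predicate variables are natural numbers. *)
Inductive qform : Type :=
| QAtom of AP & 'I_n
| QPred of nat
| QNext of 'I_n & qform
| QOr of qform & qform
| QNeg of qform
| QMu of nat & qform.

Inductive hform : Type :=
| HExists of 'I_n & hform
| HForall of 'I_n & hform
| HBody of qform.

(* All free occurrences of X in psi lie under a number of negations that is
   odd if [odd_neg] and even otherwise. *)
Fixpoint occurs_under (X : nat) (odd_neg : bool) (psi : qform) : bool :=
  match psi with
  | QAtom _ _ => true
  | QPred Y => (Y == X) ==> ~~ odd_neg
  | QNext _ psi1 => occurs_under X odd_neg psi1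
  | QOr psi1 psi2 => occurs_under X odd_neg psi1 && occurs_under X odd_neg psi2
  | QNeg psi1 => occurs_under X (~~ odd_neg) psi1
  | QMu Y psi1 => (Y == X) || occurs_under X odd_neg psi1
  end.

Fixpoint qwf (psi : qform) : bool :=
  match psi with
  | QAtom _ _ | QPred _ => true
  | QNext _ psi1 | QNeg psi1 => qwf psi1
  | QOr psi1 psi2 => qwf psi1 && qwf psi2
  | QMu X psi1 => occurs_under X false psi1 && qwf psi1
  end.

Fixpoint wf (phi : hform) : bool :=
  match phi with
  | HExists _ phi1 | HForall _ phi1 => wf phi1
  | HBody psi => qwf psi
  end.

Fixpoint free_preds (psi : qform) : seq nat :=
  match psi with
  | QAtom _ _ => [::]
  | QPred X => [:: X]
  | QNext _ psi1 | QNeg psi1 => free_preds psi1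
  | QOr psi1 psi2 => free_preds psi1 ++ free_preds psi2
  | QMu X psi1 => [seq Y <- free_preds psi1 | Y != X]
  end.

Fixpoint qpaths (psi : qform) : seq 'I_n :=
  match psi with
  | QAtom _ p => [:: p]
  | QPred _ => [::]
  | QNext p psi1 => p :: qpaths psi1
  | QOr psi1 psi2 => qpaths psi1 ++ qpaths psi2
  | QNeg psi1 | QMu _ psi1 => qpaths psi1
  end.

Fixpoint free_paths (phi : hform) : seq 'I_n :=
  match phi with
  | HExists p phi1 | HForall p phi1 => [seq q <- free_paths phi1 | q != p]
  | HBody psi => qpaths psi
  end.

Fixpoint body (phi : hform) : qform :=
  match phi with
  | HExists _ phi1 | HForall _ phi1 => body phi1
  | HBody psi => psi
  end.

Definition hclosed (phi : hform) : bool :=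
  nilp (free_paths phi) && nilp (free_preds (body phi)).

End Syntax.

Arguments QPred {AP n}.

Definition trace (AP : finType) : Type := nat -> {set AP}.

Section Semantics.
Variables (AP : finType) (n : nat) (T : set (trace AP)).

(* Partial maps from path variables to traces in T. *)
Definition assignment : Type := 'I_n -> option T.

Definition position : Type := {ffun 'I_n -> nat}.

Definition advance (p : 'I_n) (j : position) : position :=
  [ffun q => j q + (q == p)].

Definition denotation : Type := assignment -> set position.

Definition denotation_le (xi eta : denotation) : Prop :=
  forall Pi, xi Pi `<=` eta Pi.

(* Knaster-Tarski; see [lfp_least] and [qsem_Mu_least]. *)
Definition lfp (F : denotation -> denotation) : denotation :=
  fun Pi => [set j | forall xi, denotation_le (F xi) xi -> xi Pi j].

Definition is_least_fixpoint (F : denotation -> denotation) (xi : denotation) :=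
  F xi = xi /\ forall eta, F eta = eta -> denotation_le xi eta.

Definition valuation : Type := nat -> denotation.

(* The value of an atom at an unassigned path variable is irrelevant for closed
   formulas. *)
Fixpoint qsem (psi : qform AP n) (V : valuation) : denotation :=
  match psi with
  | QAtom a p => fun Pi =>
      [set j | if Pi p is Some t then a \in (val t) (j p) else False]
  | QPred X => V X
  | QNext p psi1 => fun Pi => [set j | qsem psi1 V Pi (advance p j)]
  | QOr psi1 psi2 => fun Pi => qsem psi1 V Pi `|` qsem psi2 V Pi
  | QNeg psi1 => fun Pi => ~` qsem psi1 V Pi
  | QMu X psi1 => lfp (fun xi => qsem psi1 [eta V with X |-> xi])
  end.

Fixpoint hsat (Pi : assignment) (phi : hform AP n) : Prop :=
  match phi with
  | HExists p phi1 => exists t : T, hsat [eta Pi with p |-> Some t] phi1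
  | HForall p phi1 => forall t : T, hsat [eta Pi with p |-> Some t] phi1
  | HBody psi => exists V : valuation, qsem psi V Pi [ffun=> 0]
  end.

Definition models (phi : hform AP n) : Prop := hsat (fun=> None) phi.

Lemma lfp_least (F : denotation -> denotation) :
  (forall xi eta, denotation_le xi eta -> denotation_le (F xi) (F eta)) ->
  is_least_fixpoint F (lfp F).
Proof.
move=> Fmono.
have pre : denotation_le (F (lfp F)) (lfp F).
  move=> Pi j Fj xi Fxi; apply: (Fxi); apply: (Fmono (lfp F)) Fj => Pi' j'.
  by apply.
split=> [|eta Feta Pi j]; last by apply; rewrite Feta => Pi' j'.
apply: funext => Pi; apply/seteqP; split; first exact: pre.
by move=> j; apply; apply: Fmono.
Qed.

Lemma qsem_mono (psi : qform AP n) (V V' : valuation) :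
  (forall X, ~~ occurs_under X true psi -> denotation_le (V X) (V' X)) ->
  (forall X, ~~ occurs_under X false psi -> denotation_le (V' X) (V X)) ->
  denotation_le (qsem psi V) (qsem psi V').
Proof.
elim: psi V V' => [a p|X|p psi IH|psi1 IH1 psi2 IH2|psi IH|X psi IH] V V' /=.
- by move=> _ _ Pi j.
- by move=> h _; apply: h; rewrite eqxx.
- by move=> h h' Pi j; apply: IH h h' Pi _.
- move=> h h' Pi j [] hj; [left; move: Pi j hj; apply: IH1
    |right; move: Pi j hj; apply: IH2] => X nX.
  + by apply: h; rewrite negb_and nX.
  + by apply: h'; rewrite negb_and nX.
  + by apply: h; rewrite negb_and nX orbT.
  + by apply: h'; rewrite negb_and nX orbT.
- by move=> h h' Pi j nj hj; apply: nj; apply: (IH V' V h' h Pi j hj).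
- move=> h h' Pi j hj xi hxi; apply: hj => Pi' j' hj'.
  apply: hxi; move: Pi' j' hj'; apply: IH => Y nY /=;
    case: (eqVneq Y X) => [_ ? ?|YX] //.
  + by apply: h; rewrite eq_sym (negPf YX).
  + by apply: h'; rewrite eq_sym (negPf YX).
Qed.

Lemma qsem_Mu_least X (psi : qform AP n) (V : valuation) :
  qwf (QMu X psi) ->
  is_least_fixpoint (fun xi => qsem psi [eta V with X |-> xi])
    (qsem (QMu X psi) V).
Proof.
move=> /= /andP[oX _]; apply: lfp_least => xi eta le_xi.
by apply: qsem_mono => Y /=; case: (eqVneq Y X) => [->|_ _ ? ?] //; rewrite oX.
Qed.

End Semantics.

(* Formulas with path variables pi_1, ..., pi_n for an arbitrary n. *)
Definition formula (AP : finType) : Type := {n : nat & hform AP n}.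

Definition satisfiable (AP : finType) (phi : formula AP) : Prop :=
  exists T : set (trace AP), T !=set0 /\ models T (projT2 phi).

Definition pair_code (x y : nat) : nat := Cantor.to_nat (x, y).

Fixpoint qcode (AP : finType) (n : nat) (psi : qform AP n) : nat :=
  match psi with
  | QAtom a p => pair_code 0 (pair_code (enum_rank a) p)
  | QPred X => pair_code 1 X
  | QNext p psi1 => pair_code 2 (pair_code p (qcode psi1))
  | QOr psi1 psi2 => pair_code 3 (pair_code (qcode psi1) (qcode psi2))
  | QNeg psi1 => pair_code 4 (qcode psi1)
  | QMu X psi1 => pair_code 5 (pair_code X (qcode psi1))
  end.

Fixpoint hcode (AP : finType) (n : nat) (phi : hform AP n) : nat :=
  match phi with
  | HExists p phi1 => pair_code 0 (pair_code p (hcode phi1))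
  | HForall p phi1 => pair_code 1 (pair_code p (hcode phi1))
  | HBody psi => pair_code 2 (qcode psi)
  end.

Definition code (AP : finType) (phi : formula AP) : nat :=
  pair_code (projT1 phi) (hcode (projT2 phi)).

Lemma pair_code_inj x y x' y' :
  pair_code x y = pair_code x' y' -> x = x' /\ y = y'.
Proof. by move=> /Cantor.to_nat_inj[]. Qed.

Lemma qcode_inj (AP : finType) (n : nat) : injective (@qcode AP n).
Proof.
elim=> [a p|X|p psi IH|psi1 IH1 psi2 IH2|psi IH|X psi IH]
       [b q|Y|q chi|chi1 chi2|chi|Y chi] //= /pair_code_inj[] //.
- by move=> _ /pair_code_inj[/val_inj/enum_rank_inj-> /val_inj->].
- by move=> _ ->.
- by move=> _ /pair_code_inj[/val_inj-> /IH->].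
- by move=> _ /pair_code_inj[/IH1-> /IH2->].
- by move=> _ /IH->.
- by move=> _ /pair_code_inj[-> /IH->].
Qed.

Lemma hcode_inj (AP : finType) (n : nat) : injective (@hcode AP n).
Proof.
elim=> [p phi IH|p phi IH|psi] [q chi|q chi|chi] //= /pair_code_inj[] //.
- by move=> _ /pair_code_inj[/val_inj-> /IH->].
- by move=> _ /pair_code_inj[/val_inj-> /IH->].
- by move=> _ /qcode_inj->.
Qed.

Lemma code_inj (AP : finType) : injective (@code AP).
Proof.
move=> [n phi] [m chi] /pair_code_inj[/= nm]; subst m.
by move=> /hcode_inj->.
Qed.

Definition hmu_sat (AP : finType) : set nat :=
  [set c | exists phi : formula AP,
     [/\ c = code phi, wf (projT2 phi), hclosed (projT2 phi) & satisfiable phi]].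

(* Total recursive functions of several arguments; [rec_min] is minimization
   of a regular function. *)
Inductive recursive : forall k, (k.-tuple nat -> nat) -> Prop :=
| rec_zero k (h : k.-tuple nat -> nat) :
    (forall v, h v = 0) -> recursive h
| rec_succ (h : 1.-tuple nat -> nat) :
    (forall v, h v = (thead v).+1) -> recursive h
| rec_proj k (i : 'I_k) (h : k.-tuple nat -> nat) :
    (forall v, h v = tnth v i) -> recursive h
| rec_comp k m (f : m.-tuple nat -> nat) (g : 'I_m -> k.-tuple nat -> nat)
    (h : k.-tuple nat -> nat) :
    recursive f -> (forall i, recursive (g i)) ->
    (forall v, h v = f [tuple g i v | i < m]) -> recursive h
| rec_prim k (f : k.-tuple nat -> nat) (g : k.+2.-tuple nat -> nat)
    (h : k.+1.-tuple nat -> nat) :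
    recursive f -> recursive g ->
    (forall v : k.-tuple nat, h [tuple of 0 :: v] = f v) ->
    (forall m (v : k.-tuple nat),
       h [tuple of m.+1 :: v] = g [tuple of m :: h [tuple of m :: v] :: v]) ->
    recursive h
| rec_min k (f : k.+1.-tuple nat -> nat) (h : k.-tuple nat -> nat) :
    recursive f ->
    (forall v : k.-tuple nat, f [tuple of h v :: v] = 0) ->
    (forall (v : k.-tuple nat) m, m < h v -> f [tuple of m :: v] != 0) ->
    recursive h.

Definition computable (f : nat -> nat) : Prop :=
  recursive (fun v : 1.-tuple nat => f (thead v)).

Definition one_reducible (A B : set nat) : Prop :=
  exists f : nat -> nat,
    [/\ computable f, injective f & forall x, A x <-> B (f x)].

(* Second-order arithmetic in the language 0, 1, +, *, =, <, \in; number
   variables and set variables are both named by natural numbers. *)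
Inductive so_term : Type :=
| TVar of nat
| TZero
| TOne
| TAdd of so_term & so_term
| TMul of so_term & so_term.

Inductive so_form : Type :=
| SOEq of so_term & so_term
| SOLt of so_term & so_term
| SOIn of so_term & nat
| SONot of so_form
| SOAnd of so_form & so_form
| SOEx1 of nat & so_form
| SOAll1 of nat & so_form
| SOEx2 of nat & so_form
| SOAll2 of nat & so_form.

Fixpoint so_eval (rho : nat -> nat) (t : so_term) : nat :=
  match t with
  | TVar x => rho x
  | TZero => 0
  | TOne => 1
  | TAdd t1 t2 => so_eval rho t1 + so_eval rho t2
  | TMul t1 t2 => so_eval rho t1 * so_eval rho t2
  end.

Fixpoint so_sat (rho : nat -> nat) (eta : nat -> set nat) (psi : so_form) :
    Prop :=
  match psi with
  | SOEq t1 t2 => so_eval rho t1 = so_eval rho t2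
  | SOLt t1 t2 => so_eval rho t1 < so_eval rho t2
  | SOIn t X => eta X (so_eval rho t)
  | SONot psi1 => ~ so_sat rho eta psi1
  | SOAnd psi1 psi2 => so_sat rho eta psi1 /\ so_sat rho eta psi2
  | SOEx1 x psi1 => exists m : nat, so_sat [eta rho with x |-> m] eta psi1
  | SOAll1 x psi1 => forall m : nat, so_sat [eta rho with x |-> m] eta psi1
  | SOEx2 X psi1 => exists S : set nat, so_sat rho [eta eta with X |-> S] psi1
  | SOAll2 X psi1 => forall S : set nat, so_sat rho [eta eta with X |-> S] psi1
  end.

Fixpoint arithmetical (psi : so_form) : bool :=
  match psi with
  | SOEq _ _ | SOLt _ _ | SOIn _ _ => true
  | SONot psi1 | SOEx1 _ psi1 | SOAll1 _ psi1 => arithmetical psi1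
  | SOAnd psi1 psi2 => arithmetical psi1 && arithmetical psi2
  | SOEx2 _ _ | SOAll2 _ _ => false
  end.

Fixpoint Pi11 (psi : so_form) : bool :=
  if psi is SOAll2 _ psi1 then Pi11 psi1 else arithmetical psi.

Fixpoint Sigma12 (psi : so_form) : bool :=
  if psi is SOEx2 _ psi1 then Sigma12 psi1 else Pi11 psi.

(* The number variable 0 is the argument.  Quantifying over all valuations makes
   the other variables irrelevant, so no parameters are allowed. *)
Definition Sigma12_set (A : set nat) : Prop :=
  exists2 psi : so_form, Sigma12 psi &
    forall (rho : nat -> nat) (eta : nat -> set nat),
      A (rho 0) <-> so_sat rho eta psi.

Definition Sigma12_hard (B : set nat) : Prop :=
  forall A : set nat, Sigma12_set A -> one_reducible A B.

(* Main.v *)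
Require Import Defs.
From mathcomp Require Import all_boot.
From mathcomp Require Import boolp classical_sets zify.

(* A formula with only existential path quantifiers suffices.  For fixed traces, the
   fixpoint formulas over positions in N^n express first-order arithmetic with
   unary predicates: number variables are coordinates, quantifiers move a fresh
   coordinate forward, and predicates are read off further traces.
   All number coordinates carry one aperiodic trace, so that two numbers are equal
   iff the suffixes they start agree; sums and products are least fixpoints.  One
   more least fixpoint expresses that a definable relation, along which numbers
   do not decrease, has no infinite chain starting at 0.

   It remains to write a Sigma^1_2 property (exists X, for all Y, theta) as the
   existence of sets satisfying a first-order condition and making a definable
   relation well-founded.  A counterexample Y to theta is turned into one function
   h giving the truth values of all instances of subformulas of theta, with
   witnesses for quantifiers; that h is correct is a condition on finitely many
   values at a time.  The sets encode the tree of all finite sequences of numbers,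
   and the relation is its restriction to the sequences without a visible error,
   whose infinite branches are exactly the counterexamples. *)

Set Implicit Arguments.
Unset Strict Implicit.
Unset Printing Implicit Defensive.

(** * Computability of codes *)

Lemma recursive_const k c : recursive (fun _ : k.-tuple nat => c).
Proof.
elim: c => [|c IH]; first exact: rec_zero.
apply: (@rec_comp k 1 (fun v => (thead v).+1) (fun _ _ => c)) => //.
- exact: rec_succ.
- by move=> v; rewrite /thead tnth_mktuple.
Qed.

Lemma recursive_comp1 k (f : nat -> nat) (g : k.-tuple nat -> nat) :
  computable f -> recursive g -> recursive (fun v => f (g v)).
Proof.
move=> rf rg; apply: (@rec_comp k 1 _ (fun _ => g) _ rf) => // v.
by rewrite /thead tnth_mktuple.
Qed.

Lemma recursive_addn k (f g : k.-tuple nat -> nat) :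
  recursive f -> recursive g -> recursive (fun v => f v + g v).
Proof.
move=> rf rg.
have radd : recursive (fun v : 2.-tuple nat => tnth v ord0 + tnth v ord_max).
  apply: (@rec_prim 1 (fun v => thead v)
      (fun v => (tnth v (inord 1 : 'I_3)).+1)).
  - exact: (@rec_proj 1 ord0).
  - apply: (@rec_comp 3 1 (fun v => (thead v).+1)
              (fun _ v => tnth v (inord 1 : 'I_3))) => [|i|v].
    + exact: rec_succ.
    + exact: (@rec_proj 3 (inord 1)).
    + by rewrite /thead tnth_mktuple.
  - by move=> v; rewrite /thead !(tnth_nth 0) /=.
  - by move=> m v; rewrite !(tnth_nth 0) /= !inordK //= (tnth_nth 0).
apply: (@rec_comp k 2 _ (fun i => if i == ord0 then f else g) _ radd) => [i|v].
  by case: ifP.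
by rewrite !tnth_mktuple.
Qed.

Lemma computable_nat_rec c (g : nat -> nat -> nat) (f : nat -> nat) :
  recursive (fun v : 2.-tuple nat => g (tnth v ord0) (tnth v ord_max)) ->
  f 0 = c -> (forall m, f m.+1 = g m (f m)) -> computable f.
Proof.
move=> rg f0 fS.
apply: (@rec_prim 0 (fun=> c) _ _ (recursive_const 0 c) rg) => [v|m v].
  by rewrite theadE.
by rewrite !theadE fS !(tnth_nth 0).
Qed.

(** The recursor is the one to which [Cantor.to_nat] unfolds: the code of (x, y) is y plus the
    triangular number of x + y. *)
Lemma computable_triangle :
  computable (nat_rec (fun=> nat) 0 (fun i m => i.+1 + m)).
Proof.
apply: (@computable_nat_rec 0 (fun i m => i.+1 + m)) => //.
apply: recursive_addn; last exact: (@rec_proj 2 ord_max).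
apply: (recursive_comp1 (f := S)); last exact: (@rec_proj 2 ord0).
exact: rec_succ.
Qed.

Lemma recursive_pair_code k (f g : k.-tuple nat -> nat) :
  recursive f -> recursive g -> recursive (fun v => pair_code (f v) (g v)).
Proof.
move=> rf rg; apply: recursive_addn => //.
by apply: (recursive_comp1 computable_triangle); apply: recursive_addn.
Qed.

Lemma computable_pair_code c f :
  computable f -> computable (fun x => pair_code c (f x)).
Proof. by move=> rf; apply: recursive_pair_code => //; apply: recursive_const. Qed.

(** This is how the code of x nested next operators depends on x; each operator contributes two
    pairings. *)
Lemma computable_iter_pair_code a b c :
  computable (fun x => iter x (fun z => pair_code a (pair_code b z)) c).
Proof.
apply: (@computable_nat_rec c (fun _ z => pair_code a (pair_code b z))) => //.
apply: recursive_pair_code; first exact: recursive_const.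
apply: recursive_pair_code; first exact: recursive_const.
exact: (@rec_proj 2 ord_max).
Qed.

(** * Fixpoint formulas for fixed traces *)

(* [inl p] are the coordinates holding numbers, and the trace at [inr X] encodes
   the set X. *)
Definition coord : Type := (nat + nat)%type.

Definition gpos : Type := coord -> nat.

Inductive gform : Type :=
| GBit of coord
| GPred of nat
| GNext of coord & gform
| GOr of gform & gform
| GNeg of gform
| GMu of nat & gform.

Definition incr_pos (c : coord) (f : gpos) : gpos := fun d => f d + (d == c).

(** With the traces fixed, denotations are sets of positions. Positions have infinitely many
    coordinates, so that the number of path variables can be settled at the end. The clause for
    [GMu] intersects all prefixed points, as [lfp] does. *)
Fixpoint gsem (L : coord -> nat -> bool) (phi : gform)
    (V : nat -> gpos -> Prop) : gpos -> Prop :=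
  match phi with
  | GBit c => fun f => L c (f c)
  | GPred X => V X
  | GNext c phi1 => fun f => gsem L phi1 V (incr_pos c f)
  | GOr phi1 phi2 => fun f => gsem L phi1 V f \/ gsem L phi2 V f
  | GNeg phi1 => fun f => ~ gsem L phi1 V f
  | GMu X phi1 => fun f => forall xi : gpos -> Prop,
      (forall g, gsem L phi1 [eta V with X |-> xi] g -> xi g) -> xi f
  end.

Definition cindex (c : coord) : nat :=
  match c with inl p => p.*2 | inr X => X.*2.+1 end.

(** The largest path index in the formula; N + 1 path variables suffice once it is at most N. *)
Fixpoint gsize (phi : gform) : nat :=
  match phi with
  | GBit c => cindex c
  | GPred _ => 0
  | GNext c phi1 => maxn (cindex c) (gsize phi1)
  | GOr phi1 phi2 => maxn (gsize phi1) (gsize phi2)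
  | GNeg phi1 | GMu _ phi1 => gsize phi1
  end.

Fixpoint gfree (phi : gform) : seq nat :=
  match phi with
  | GBit _ => [::]
  | GPred X => [:: X]
  | GNext _ phi1 | GNeg phi1 => gfree phi1
  | GOr phi1 phi2 => gfree phi1 ++ gfree phi2
  | GMu X phi1 => [seq Y <- gfree phi1 | Y != X]
  end.

Fixpoint gocc (X : nat) (odd_neg : bool) (phi : gform) : bool :=
  match phi with
  | GBit _ => true
  | GPred Y => (Y == X) ==> ~~ odd_neg
  | GNext _ phi1 => gocc X odd_neg phi1
  | GOr phi1 phi2 => gocc X odd_neg phi1 && gocc X odd_neg phi2
  | GNeg phi1 => gocc X (~~ odd_neg) phi1
  | GMu Y phi1 => (Y == X) || gocc X odd_neg phi1
  end.

Fixpoint gwf (phi : gform) : bool :=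
  match phi with
  | GBit _ | GPred _ => true
  | GNext _ phi1 | GNeg phi1 => gwf phi1
  | GOr phi1 phi2 => gwf phi1 && gwf phi2
  | GMu X phi1 => gocc X false phi1 && gwf phi1
  end.

Lemma gocc_notin X b phi : X \notin gfree phi -> gocc X b phi.
Proof.
elim: phi b => [c|Y|c phi IH|phi1 IH1 phi2 IH2|phi IH|Y phi IH] b //=.
- by rewrite inE eq_sym => /negPf->.
- exact: IH.
- by rewrite mem_cat negb_or => /andP[/IH1-> /IH2->].
- exact: IH.
- rewrite mem_filter negb_and negbK => /orP[/eqP->|/IH->]; last by rewrite orbT.
  by rewrite eqxx.
Qed.

Lemma gsem_indep L phi V V' :
  (forall X, X \in gfree phi -> V X = V' X) -> gsem L phi V = gsem L phi V'.
Proof.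
elim: phi V V' => [c|X|c phi IH|phi1 IH1 phi2 IH2|phi IH|X phi IH] V V' //= eqV.
- by apply: eqV; rewrite inE.
- by rewrite (IH _ _ eqV).
- rewrite (IH1 V V') ?(IH2 V V') // => X hX; apply: eqV;
    by rewrite mem_cat hX ?orbT.
- by rewrite (IH _ _ eqV).
- have eqxi xi : gsem L phi [eta V with X |-> xi] =
                 gsem L phi [eta V' with X |-> xi].
    apply: IH => Y hY /=; case: eqP => // /eqP YX.
    by apply: eqV; rewrite mem_filter YX.
  by apply/funext => f; apply/propext; split=> h xi hxi; apply: h;
    move=> g; [rewrite eqxi|rewrite -eqxi]; apply: hxi.
Qed.

Lemma gsem_eq_le L L' N phi V :
  (forall c, cindex c <= N -> L c = L' c) -> gsize phi <= N ->
  gsem L phi V = gsem L' phi V.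
Proof.
move=> LL'; elim: phi V => [c|X|c phi IH|phi1 IH1 phi2 IH2|phi IH|X phi IH] V //=.
- by move=> cN; rewrite LL'.
- by rewrite geq_max => /andP[_ phiN]; rewrite IH.
- by rewrite geq_max => /andP[phi1N phi2N]; rewrite IH1 // IH2.
- by move=> phiN; rewrite IH.
- move=> phiN; apply/funext => f; apply/eq_forall => xi.
  by rewrite IH.
Qed.

(** * Embedding into formulas with path variables *)

Section Embedding.
Variables (AP : finType) (a : AP) (N : nat).

Fixpoint qform_of (phi : gform) : qform AP N.+1 :=
  match phi with
  | GBit c => QAtom a (inord (cindex c))
  | GPred X => QPred X
  | GNext c phi1 => QNext (inord (cindex c)) (qform_of phi1)
  | GOr phi1 phi2 => QOr (qform_of phi1) (qform_of phi2)
  | GNeg phi1 => QNeg (qform_of phi1)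
  | GMu X phi1 => QMu X (qform_of phi1)
  end.

Lemma free_preds_qform_of phi : free_preds (qform_of phi) = gfree phi.
Proof. by elim: phi => //= [phi1 -> phi2 ->|X phi ->]. Qed.

Lemma qwf_qform_of phi : qwf (qform_of phi) = gwf phi.
Proof.
have occ X b psi : occurs_under X b (qform_of psi) = gocc X b psi.
  by elim: psi b => //= [psi1 IH1 psi2 IH2|Y psi IH] b; rewrite ?IH1 ?IH2 ?IH.
by elim: phi => //= [phi1 -> phi2 ->|X phi ->] //; rewrite occ.
Qed.

Definition gpos_of (j : position N.+1) : gpos :=
  fun c => if cindex c <= N then j (inord (cindex c)) else 0.

Lemma cindex_inj : injective cindex.
Proof.
case=> [p|X] [q|Y] /= h; try (exfalso; lia).
- by have -> : p = q by lia.
- by have -> : X = Y by lia.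
Qed.

Lemma gpos_of_advance c j :
  cindex c <= N -> gpos_of (advance (inord (cindex c)) j) = incr_pos c (gpos_of j).
Proof.
move=> cN; apply/funext => d; rewrite /gpos_of /incr_pos.
case: leqP => dN; last first.
  by case: eqP => // dc; move: dN; rewrite dc ltnNge cN.
rewrite ffunE -val_eqE /= !inordK //; congr (_ + (_ : bool)).
by apply/eqP/eqP => [/cindex_inj|->].
Qed.

Lemma gpos_of_inj : injective gpos_of.
Proof.
move=> j j' eqj; apply/ffunP => p.
pose c : coord := if odd p then inr p./2 else inl p./2.
have cp : cindex c = p.
  by rewrite /c -[RHS]odd_double_half; case: odd.
have := congr1 (@^~ c) eqj.
by rewrite /gpos_of cp -ltnS ltn_ord inord_val.
Qed.

Lemma qsem_qform_of (T : set (trace AP)) (t : 'I_N.+1 -> T)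
    (L : coord -> nat -> bool) N0 phi (V : nat -> gpos -> Prop)
    (V' : valuation N.+1 T) :
  let Pi := fun p => Some (t p) in
  gsize phi <= N0 -> N0 <= N ->
  (forall c m, cindex c <= N0 -> L c m = (a \in val (t (inord (cindex c))) m)) ->
  (forall X j, V' X Pi j <-> V X (gpos_of j)) ->
  forall j, qsem (qform_of phi) V' Pi j <-> gsem L phi V (gpos_of j).
Proof.
move=> Pi phiN N0N Lt; elim: phi phiN V V' =>
  [c|X|c phi IH|phi1 IH1 phi2 IH2|phi IH|X phi IH] /= phiN V V' hV j //.
- by rewrite Lt // /gpos_of (leq_trans phiN).
- move: phiN; rewrite geq_max => /andP[cN phiN].
  by rewrite (IH phiN V V') // gpos_of_advance // (leq_trans cN).
- move: phiN; rewrite geq_max => /andP[phi1N phi2N].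
  by have := IH1 phi1N V V' hV j; have := IH2 phi2N V V' hV j; rewrite /setU /=; tauto.
- by have := IH phiN V V' hV j; rewrite /setC /=; tauto.
- split=> h xi hxi.
  (* A prefixed point on positions becomes a denotation by imposing no condition at assignments
     other than [Pi]. *)
  + apply: (h (fun Pi' j' => Pi' = Pi -> xi (gpos_of j'))) => // Pi' j' + ePi.
    rewrite {}ePi => /(IH phiN [eta V with X |-> xi]) h'; apply/hxi/h' => Y j'' /=.
    by case: eqP => // _; split=> [|? ?] //; apply.
  + apply: (h (fun f => forall j', f = gpos_of j' -> xi Pi j')) => // f + j' ef.
    rewrite {}ef => h'; apply: hxi; apply/(IH phiN); last exact: h'.
    move=> Y j'' /=; case: eqP => // _; split=> [hj j3 /gpos_of_inj e|].
      by rewrite -e.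
    exact.
Qed.

Lemma free_paths_foldr_HExists s psi :
  free_paths (foldr (@HExists AP N.+1) (HBody psi) s) =
  [seq q <- qpaths psi | q \notin s].
Proof.
elim: s => [|p s IH] /=; first by rewrite filter_predT.
by rewrite IH -filter_predI; apply: eq_filter => q /=; rewrite inE negb_or.
Qed.

Definition ex_closure (psi : qform AP N.+1) : hform AP N.+1 :=
  foldr (@HExists AP N.+1) (HBody psi) (enum 'I_N.+1).

Lemma hclosed_ex_closure psi : free_preds psi = [::] -> hclosed (ex_closure psi).
Proof.
move=> cl; rewrite /hclosed free_paths_foldr_HExists.
rewrite (eq_filter (a2 := pred0)) => [|q]; last by rewrite mem_enum.
by rewrite filter_pred0 /ex_closure; elim: (enum _) => //=; rewrite cl.
Qed.

Lemma wf_ex_closure psi : wf (ex_closure psi) = qwf psi.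
Proof. by rewrite /ex_closure; elim: (enum _). Qed.

Lemma models_ex_closure (T : set (trace AP)) psi :
  models T (ex_closure psi) <->
  exists (t : 'I_N.+1 -> T) V, qsem psi V (fun p => Some (t p)) [ffun=> 0].
Proof.
split=> [|[t [V hV]]].
  (* Options coerce to booleans here: the assignment finally reached is defined on [s] and wherever
     [Pi] was. *)
  suff gen s (Pi : assignment N.+1 T) :
      hsat Pi (foldr (@HExists AP N.+1) (HBody psi) s) ->
      exists2 Pi' : assignment N.+1 T,
        forall p, p \in s \/ Pi p -> Pi' p & exists V, qsem psi V Pi' [ffun=> 0].
    move=> /gen[Pi' hPi' [V hV]].
    have /choice[t ht] : forall p, exists x, Pi' p = Some x.
      move=> p; have := hPi' p; rewrite mem_enum; case: (Pi' p) => [x|h].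
        by exists x.
      by have := h (or_introl isT).
    by exists t, V; rewrite (_ : (fun _ => _) = Pi') //; apply/funext => p.
  elim: s Pi => [|p s IH] Pi /=; first by move=> h; exists Pi => // p [].
  case=> x /IH[Pi' hPi' hV]; exists Pi' => // q; rewrite inE => hq.
  apply: hPi' => /=; case: (eqVneq q p) hq => [_ _|_ /=]; first by right.
  by [].
suff gen s (Pi : assignment N.+1 T) : (forall p, p \notin s -> Pi p = Some (t p)) ->
    hsat Pi (foldr (@HExists AP N.+1) (HBody psi) s).
  by apply: gen => p; rewrite mem_enum.
elim: s Pi => [|p s IH] Pi /= hPi.
  by exists V; rewrite (_ : Pi = fun p => Some (t p)) //; apply/funext => p; apply: hPi.
exists (t p); apply: IH => q qs /=; case: eqP => [->//|/eqP qp].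
by apply: hPi; rewrite inE negb_or qp.
Qed.

End Embedding.

(** * First-order arithmetic *)

Inductive fo : Type :=
| FEq of so_term & so_term
| FLt of so_term & so_term
| FIn of so_term & nat
| FNot of fo
| FAnd of fo & fo
| FImp of fo & fo
| FEx of nat & fo
| FAll of nat & fo.

Fixpoint fsat (rho : nat -> nat) (eta : nat -> set nat) (phi : fo) : Prop :=
  match phi with
  | FEq s t => so_eval rho s = so_eval rho t
  | FLt s t => so_eval rho s < so_eval rho t
  | FIn s X => eta X (so_eval rho s)
  | FNot phi1 => ~ fsat rho eta phi1
  | FAnd phi1 phi2 => fsat rho eta phi1 /\ fsat rho eta phi2
  | FImp phi1 phi2 => fsat rho eta phi1 -> fsat rho eta phi2
  | FEx x phi1 => exists m : nat, fsat [eta rho with x |-> m] eta phi1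
  | FAll x phi1 => forall m : nat, fsat [eta rho with x |-> m] eta phi1
  end.

Definition gAnd phi psi := GNeg (GOr (GNeg phi) (GNeg psi)).

Definition gNexts (cs : seq coord) (phi : gform) := foldr GNext phi cs.

(** Reachability: after some number of simultaneous steps along [cs], [phi] holds. Predicate 0 is
    reserved for this fixpoint; [gTimes] and [gAcc] bind predicate 1. *)
Definition gDia (cs : seq coord) (phi : gform) :=
  GMu 0 (GOr phi (gNexts cs (GPred 0))).

Definition gBox (cs : seq coord) (phi : gform) := GNeg (gDia cs (GNeg phi)).

Definition gImp phi psi := GOr (GNeg phi) psi.

Definition gXor phi psi :=
  GOr (gAnd phi (GNeg psi)) (gAnd (GNeg phi) psi).

(* Number coordinates all carry the same trace, no two suffixes of which agree,
   so that lockstep comparison of suffixes is equality of numbers. *)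
Definition gEq (c d : coord) := gBox [:: c; d] (GNeg (gXor (GBit c) (GBit d))).

Definition move (cs : seq coord) (m : nat) (f : gpos) : gpos :=
  fun c => f c + m * count_mem c cs.

Lemma gNegE L phi V f : gsem L (GNeg phi) V f = ~ gsem L phi V f.
Proof. by []. Qed.

Lemma gNextE L c phi V f : gsem L (GNext c phi) V f = gsem L phi V (incr_pos c f).
Proof. by []. Qed.

Lemma inlE p q : (inl p == inl q :> coord) = (p == q).
Proof. by []. Qed.

Lemma gAndE L phi psi V f :
  gsem L (gAnd phi psi) V f = (gsem L phi V f /\ gsem L psi V f).
Proof.
apply/propext => /=; split=> [h|[h1 h2] []] //.
by split; apply: contrapT => h'; apply: h; [left|right].
Qed.

Lemma gImpE L phi psi V f :
  gsem L (gImp phi psi) V f = (gsem L phi V f -> gsem L psi V f).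
Proof.
apply/propext => /=; split=> [[]|h] //.
by have [h'|] := pselect (gsem L phi V f); [right; apply: h|left].
Qed.

Lemma moveD cs m k f : move cs m (move cs k f) = move cs (m + k) f.
Proof. by apply/funext => c; rewrite /move mulnDl; lia. Qed.

Lemma move0 cs f : move cs 0 f = f.
Proof. by apply/funext => c; rewrite /move; lia. Qed.

Lemma gNextsE L cs phi V f :
  gsem L (gNexts cs phi) V f = gsem L phi V (move cs 1 f).
Proof.
elim: cs f => [|c cs IH] f /=.
  by congr gsem; apply/funext => d; rewrite /move /=; lia.
rewrite IH; congr gsem; apply/funext => d; rewrite /move /incr_pos /=.
by rewrite [c == d]eq_sym; lia.
Qed.

Lemma gDiaE L cs phi V f : 0 \notin gfree phi ->
  gsem L (gDia cs phi) V f = exists m, gsem L phi V (move cs m f).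
Proof.
move=> free0; have indep xi : gsem L phi [eta V with 0 |-> xi] = gsem L phi V.
  by apply: gsem_indep => Y hY /=; case: eqP => // Y0; rewrite -Y0 hY in free0.
apply/propext; split=> /= [h|[m hm] xi hxi].
  apply: (h (fun g => exists m, gsem L phi V (move cs m g))) => g [].
    by rewrite indep => hg; exists 0; rewrite move0.
  by rewrite gNextsE => -[m]; rewrite moveD addn1; exists m.+1.
elim: m f hm => [|m IH] f hm; first by apply/hxi; left; rewrite indep -[f](move0 cs).
by apply/hxi; right; rewrite gNextsE /=; apply: IH; rewrite moveD addn1.
Qed.

Lemma gBoxE L cs phi V f : 0 \notin gfree phi ->
  gsem L (gBox cs phi) V f = forall m, gsem L phi V (move cs m f).
Proof.
move=> free0; rewrite gNegE gDiaE //.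
apply/propext; split=> [h m|h [m]]; last by rewrite gNegE; apply; apply: h.
by apply: contrapT => h'; apply: h; exists m.
Qed.

Lemma gEqE L c d V f : gsem L (gEq c d) V f =
  forall m, L c (move [:: c; d] m f c) = L d (move [:: c; d] m f d).
Proof.
rewrite gBoxE //; apply: eq_forall => m; rewrite gNegE.
have -> g : gsem L (gXor (GBit c) (GBit d)) V g = (L c (g c) <> L d (g d)).
  have -> : gsem L (gXor (GBit c) (GBit d)) V g =
    (gsem L (gAnd (GBit c) (GNeg (GBit d))) V g \/
     gsem L (gAnd (GNeg (GBit c)) (GBit d)) V g) by [].
  rewrite !gAndE !gNegE /=; apply/propext.
  by case: (L c _); case: (L d _); split=> //;
    [case=> -[]|move=> _; left|move=> _; right|case=> -[]].
by apply/propext; split=> [/contrapT|e /(_ e)].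
Qed.

Definition gclosed phi := nilp (gfree phi) && gwf phi.

Lemma gclosed_gAnd phi psi :
  gclosed phi -> gclosed psi -> gclosed (gAnd phi psi).
Proof. by rewrite /gclosed /= => /andP[/nilP-> ->] /andP[/nilP-> ->]. Qed.

Lemma gclosed_gImp phi psi :
  gclosed phi -> gclosed psi -> gclosed (gImp phi psi).
Proof. by rewrite /gclosed /= => /andP[/nilP-> ->] /andP[/nilP-> ->]. Qed.

Lemma gfree_gNexts cs phi : gfree (gNexts cs phi) = gfree phi.
Proof. by elim: cs. Qed.

Lemma gfree_gDia cs phi : gfree (gDia cs phi) = [seq Y <- gfree phi | Y != 0].
Proof. by rewrite /= gfree_gNexts filter_cat /= cats0. Qed.

Lemma gocc_gNexts X b cs phi : gocc X b (gNexts cs phi) = gocc X b phi.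
Proof. by elim: cs. Qed.

Lemma gwf_gDia cs phi : 0 \notin gfree phi -> gwf (gDia cs phi) = gwf phi.
Proof.
move=> free0; rewrite /= gocc_gNexts gocc_notin //=.
suff -> : gwf (gNexts cs (GPred 0)) by rewrite andbT.
by elim: cs.
Qed.

Lemma gclosed_gDia cs phi : gclosed phi -> gclosed (gDia cs phi).
Proof.
rewrite /gclosed gfree_gDia => /andP[/nilP cl wf_phi].
by rewrite gwf_gDia cl // wf_phi.
Qed.

Lemma gclosed_gBox cs phi : gclosed phi -> gclosed (gBox cs phi).
Proof. exact: (@gclosed_gDia cs (GNeg phi)). Qed.

Lemma gclosed_free X phi : gclosed phi -> X \notin gfree phi.
Proof. by case/andP=> /nilP->. Qed.

(** Coordinate z counts from 0 to the value of v while u advances in lockstep, so that u ends at the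
    sum to be compared with w. *)
Definition gPlus (z u v w : nat) :=
  gDia [:: inl z; inl u] (gAnd (gEq (inl z) (inl v)) (gEq (inl u) (inl w))).

(* Coordinate 1 counts up to b, while coordinates 2 and 3 hold the corresponding
   multiple of a; coordinate 4 serves the additions. *)
Definition gTimes (a b c : nat) :=
  GMu 1 (GOr (gAnd (gEq (inl 1) (inl b)) (gEq (inl 2) (inl c)))
    (GNext (inl 1) (gDia [:: inl 3] (gAnd (gPlus 4 2 a 3)
      (gDia [:: inl 2] (gAnd (gEq (inl 2) (inl 3)) (GPred 1))))))).

Definition aperiodic (t : nat -> bool) :=
  forall a b, (forall m, t (a + m) = t (b + m)) -> a = b.

(** Coordinates 0 and 1 go to a common m, and coordinate 1 then goes on to m + k + 1; the suffixes
    starting there must never agree. *)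
Definition gAperiodic :=
  GNeg (gDia [:: inl 0; inl 1] (GNext (inl 1)
    (gDia [:: inl 1] (gEq (inl 0) (inl 1))))).

Lemma gOrE L phi psi V f :
  gsem L (GOr phi psi) V f = (gsem L phi V f \/ gsem L psi V f).
Proof. by []. Qed.

Lemma gMuE L X phi V f : gsem L (GMu X phi) V f = forall xi : gpos -> Prop,
  (forall g, gsem L phi [eta V with X |-> xi] g -> xi g) -> xi f.
Proof. by []. Qed.

Lemma gPredE L X V f : gsem L (GPred X) V f = V X f.
Proof. by []. Qed.

Definition sets_of (L : coord -> nat -> bool) : nat -> set nat :=
  fun X m => L (inr X) m.

(* [term_graph sigma d s p] says that the value of [s] is the p-th number
   coordinate, and [translate sigma d phi] says that [phi] holds, where the value
   of the variable x is the coordinate [sigma x].  Quantified values are stored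
   in the coordinates d, d + 1, ..., which are 0 to begin with, like the auxiliary
   coordinates 0, ..., 4. *)
Fixpoint term_graph (sigma : nat -> nat) (d : nat) (s : so_term) (p : nat) :
    gform :=
  match s with
  | TVar x => gEq (inl (sigma x)) (inl p)
  | TZero => gEq (inl 0) (inl p)
  | TOne => GNext (inl 0) (gEq (inl 0) (inl p))
  | TAdd s1 s2 =>
      gDia [:: inl d] (gAnd (term_graph sigma d.+1 s1 d)
        (gDia [:: inl d.+1] (gAnd (term_graph sigma d.+2 s2 d.+1)
          (gPlus 1 d d.+1 p))))
  | TMul s1 s2 =>
      gDia [:: inl d] (gAnd (term_graph sigma d.+1 s1 d)
        (gDia [:: inl d.+1] (gAnd (term_graph sigma d.+2 s2 d.+1)
          (gTimes d d.+1 p))))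
  end.

Definition gLt (p q : nat) :=
  GNext (inl p) (gDia [:: inl p] (gEq (inl p) (inl q))).

(** The coordinate of a set trace rests at 0; it is moved together with coordinate 1 until the
    latter equals p, and then the bit is read. *)
Definition gIn (p X : nat) :=
  gDia [:: inl 1; inr X] (gAnd (gEq (inl 1) (inl p)) (GBit (inr X))).

Fixpoint translate (sigma : nat -> nat) (d : nat) (phi : fo) : gform :=
  match phi with
  | FEq s1 s2 =>
      gDia [:: inl d] (gAnd (term_graph sigma d.+1 s1 d)
                            (term_graph sigma d.+1 s2 d))
  | FLt s1 s2 =>
      gDia [:: inl d] (gAnd (term_graph sigma d.+1 s1 d)
        (gDia [:: inl d.+1] (gAnd (term_graph sigma d.+2 s2 d.+1)
          (gLt d d.+1))))
  | FIn s X => gDia [:: inl d] (gAnd (term_graph sigma d.+1 s d) (gIn d X))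
  | FNot phi1 => GNeg (translate sigma d phi1)
  | FAnd phi1 phi2 => gAnd (translate sigma d phi1) (translate sigma d phi2)
  | FImp phi1 phi2 => gImp (translate sigma d phi1) (translate sigma d phi2)
  | FEx x phi1 => gDia [:: inl d] (translate [eta sigma with x |-> d] d.+1 phi1)
  | FAll x phi1 => gBox [:: inl d] (translate [eta sigma with x |-> d] d.+1 phi1)
  end.

Lemma gclosed_term_graph sigma d s p : gclosed (term_graph sigma d s p).
Proof.
elim: s d p => [x|||s1 IH1 s2 IH2|s1 IH1 s2 IH2] d p //=;
  do 2 (apply/gclosed_gDia/gclosed_gAnd => //).
Qed.

Lemma gclosed_translate sigma d phi : gclosed (translate sigma d phi).
Proof.
elim: phi sigma d => [s1 s2|s1 s2|s X|phi IH|phi1 IH1 phi2 IH2|phi1 IH1 phi2 IH2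
    |x phi IH|x phi IH] sigma d /=.
- by apply/gclosed_gDia/gclosed_gAnd; apply: gclosed_term_graph.
- apply/gclosed_gDia/gclosed_gAnd; first exact: gclosed_term_graph.
  by apply/gclosed_gDia/gclosed_gAnd; first exact: gclosed_term_graph.
- by apply/gclosed_gDia/gclosed_gAnd; first exact: gclosed_term_graph.
- exact: IH.
- exact: gclosed_gAnd.
- exact: gclosed_gImp.
- exact: gclosed_gDia.
- exact: gclosed_gBox.
Qed.
#[local] Arguments gsem : simpl never.

(** * Meaning of the formulas when all number coordinates carry one trace *)

Section NumberCoordinates.
Variables (L : coord -> nat -> bool) (t : nat -> bool).
Hypothesis Lt : forall p, L (inl p) = t.

Lemma gAperiodicE V f : f (inl 0) = 0 -> f (inl 1) = 0 ->
  gsem L gAperiodic V f <-> aperiodic t.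
Proof.
move=> f0 f1; rewrite gNegE gDiaE //.
have step m : gsem L (GNext (inl 1) (gDia [:: inl 1] (gEq (inl 0) (inl 1)))) V
     (move [:: inl 0; inl 1] m f) <->
   exists k, forall i, t (m + i) = t (m + k.+1 + i).
  rewrite gNextE gDiaE //.
  split=> -[k hk]; exists k; [move=> i; have := hk|]; rewrite gEqE !Lt.
    move=> /(_ i); rewrite /move /incr_pos /= f0 f1.
    move=> hi; etransitivity; [|etransitivity; [exact: hi|]]; congr t; lia.
  move=> i; rewrite /move /incr_pos /= f0 f1.
  by etransitivity; [|etransitivity; [exact: (hk i)|]]; congr t; lia.
split=> [h a b hab|ap [m /step[k hk]]]; last by have := ap _ _ hk; lia.
apply/eqP; apply: contrapT => /eqP ab; apply: h.
case: (ltngtP a b) ab => // [ab|ba] _; [exists a|exists b]; apply/step.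
  by exists (b - a.+1) => i; rewrite hab; congr t; lia.
by exists (a - b.+1) => i; rewrite -hab; congr t; lia.
Qed.

Hypothesis ap : aperiodic t.

Lemma gEq_inl V f p q :
  gsem L (gEq (inl p) (inl q)) V f = (f (inl p) = f (inl q)).
Proof.
rewrite gEqE !Lt; apply/propext; split=> [h|e m].
  case: (eqVneq p q) => [->//|pq]; apply: ap => m.
  have := h m; rewrite /move /= !eqxx.
  rewrite !inlE [q == p]eq_sym (negPf pq) => hm.
  by etransitivity; [|etransitivity; [exact: hm|]]; congr t; lia.
by rewrite /move /= e !eqxx !inlE [q == p]eq_sym; congr t; lia.
Qed.

Lemma gPlusE V f z u v w : uniq [:: z; u; v; w] -> f (inl z) = 0 ->
  gsem L (gPlus z u v w) V f = (f (inl u) + f (inl v) = f (inl w)).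
Proof.
rewrite [uniq _]/= !inE !negb_or => /and4P[/and3P[zu zv zw] /andP[uv uw] vw _] fz.
have E m : gsem L (gAnd (gEq (inl z) (inl v)) (gEq (inl u) (inl w))) V
    (move [:: inl z; inl u] m f) = (m = f (inl v) /\ f (inl u) + m = f (inl w)).
  rewrite gAndE !gEq_inl /move /= !inlE !eqxx fz [u == z]eq_sym.
  rewrite (negPf zu) (negPf zv) (negPf uv) (negPf zw) (negPf uw) /=.
  by apply/propext; split=> -[e1 e2]; split; lia.
rewrite /gPlus gDiaE //; apply/propext; split=> [[m]|h]; first by rewrite E => -[<-].
by exists (f (inl v)); rewrite E.
Qed.

Lemma gTimesE V f a b c : 4 < a -> 4 < b -> 4 < c ->
  (forall q, q < 5 -> f (inl q) = 0) ->
  gsem L (gTimes a b c) V f = (f (inl a) * f (inl b) = f (inl c)).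
Proof.
move=> a4 b4 c4 f0.
(* Between two rounds the number coordinates from 4 on are as at the start, and coordinates 2 and 3
   agree. *)
pose inv (g : gpos) := (forall q, 3 < q -> g (inl q) = f (inl q)) /\
  g (inl 2) = g (inl 3).
pose body := GNext (inl 1) (gDia [:: inl 3] (gAnd (gPlus 4 2 a 3)
      (gDia [:: inl 2] (gAnd (gEq (inl 2) (inl 3)) (GPred 1))))).
have baseE V' g : inv g ->
    gsem L (gAnd (gEq (inl 1) (inl b)) (gEq (inl 2) (inl c))) V' g =
    (g (inl 1) = f (inl b) /\ g (inl 2) = f (inl c)).
  by move=> [hg _]; rewrite gAndE !gEq_inl (hg b) ?(hg c) //; lia.
(* One round: coordinate 1 grows by 1, and coordinates 2 and 3 both grow by the value of a. *)
have bodyE xi g : inv g ->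
    gsem L body [eta V with 1 |-> xi] g =
    xi (move [:: inl 2; inl 3] (f (inl a)) (incr_pos (inl 1) g)).
  move=> [hg g23]; rewrite gNextE gDiaE //.
  have E m : gsem L (gAnd (gPlus 4 2 a 3)
        (gDia [:: inl 2] (gAnd (gEq (inl 2) (inl 3)) (GPred 1))))
        [eta V with 1 |-> xi] (move [:: inl 3] m (incr_pos (inl 1) g)) <->
      m = f (inl a) /\ xi (move [:: inl 2; inl 3] m (incr_pos (inl 1) g)).
    have e3 : (3 == a) = false by lia.
    have e1 : (a == 1) = false by lia.
    have e2 : (2 == a) = false by lia.
    have ga := hg a; have g4 := hg 4.
    rewrite gAndE gPlusE; last 2 first.
    - by rewrite /= !inE; lia.
    - by rewrite /move /incr_pos /= hg // f0 //; lia.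
    rewrite gDiaE // /move /incr_pos /= !inlE e3 e1 ga ?g23; last by lia.
    split=> [[e [k]]|[-> hxi]].
      rewrite gAndE gEq_inl gPredE /move /= => -[e' hxi]; split; first by lia.
      have km : k = m by move: e'; rewrite g23; lia.
      move: hxi; rewrite km; congr xi; apply/funext => d.
      by lia.
    split; first by lia.
    exists (f (inl a)); rewrite gAndE gEq_inl gPredE /move /=; split; first by lia.
    by move: hxi => /=; congr xi; apply/funext => d; lia.
  apply/propext; split=> [[m /E[->]]//|h].
  by exists (f (inl a)); apply/E.
have inv_step g : inv g -> inv (move [:: inl 2; inl 3] (f (inl a)) (incr_pos (inl 1) g)).
  move=> [hg g23]; split=> [q q3|]; rewrite /move /incr_pos /= ?inlE.
    by rewrite hg //; lia.
  by rewrite g23; lia.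
have inv_f : inv f by split=> //; rewrite !f0.
rewrite /gTimes gMuE -/body; apply/propext; split=> [h|].
  (* Here k is the number of rounds still to come. Nothing is claimed outside [inv], which makes
     this a prefixed point. *)
  pose xi g := inv g -> exists k,
    g (inl 1) + k = f (inl b) /\ g (inl 2) + k * f (inl a) = f (inl c).
  have [|//|k] := h xi; last by rewrite (f0 1) // (f0 2) // => -[<- <-]; lia.
  move=> g + inv_g; rewrite gOrE baseE // bodyE // => -[[<- <-]|].
    by exists 0; lia.
  move=> /(_ (inv_step _ inv_g))[k].
  by rewrite /move /incr_pos /= => -[e1 e2]; exists k.+1; split; lia.
move=> e xi hxi.
suff gen k g : inv g -> g (inl 1) + k = f (inl b) ->
    g (inl 2) + k * f (inl a) = f (inl c) -> xi g.
  by apply: (gen (f (inl b))); rewrite ?(f0 1) ?(f0 2) // mulnC.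
elim: k g => [|k IH] g inv_g e1 e2; apply: hxi;
  rewrite gOrE baseE // bodyE //; [left; lia|right].
apply: IH; first exact: inv_step.
- by rewrite /move /incr_pos /=; lia.
- by rewrite /move /incr_pos /=; lia.
Qed.

Definition fresh (d : nat) (f : gpos) :=
  (forall q, (q < 5) || (d <= q) -> f (inl q) = 0) /\ forall X, f (inr X) = 0.

Lemma move_fresh d m f : fresh d f -> 4 < d ->
  [/\ forall q, q < d -> move [:: inl d] m f (inl q) = f (inl q),
      move [:: inl d] m f (inl d) = m & fresh d.+1 (move [:: inl d] m f)].
Proof.
move=> [f0 fr] d4; rewrite /move; split=> [q qd||]; last split=> [q hq|X] /=.
- by rewrite /= inlE; lia.
- by rewrite /= inlE eqxx f0 ?leqnn ?orbT //; lia.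
- by rewrite inlE f0; lia.
- by rewrite fr muln0.
Qed.

Lemma so_eval_move sigma d m f s : fresh d f -> 4 < d ->
  (forall x, sigma x < d) ->
  so_eval (fun x => move [:: inl d] m f (inl (sigma x))) s =
  so_eval (fun x => f (inl (sigma x))) s.
Proof.
move=> fd d4 sd; congr (so_eval _ s); apply/funext => x.
by have [lo _ _] := move_fresh m fd d4; rewrite lo.
Qed.

(** The graph of [s] holds for exactly one number of steps, so the diamond acts as an assignment: it
    stores the value of [s] in coordinate d and continues with [phi]. *)
Lemma gDia_graph sigma d s phi V f :
  fresh d f -> 4 < d -> (forall x, sigma x < d) -> gclosed phi ->
  (forall g, fresh d.+1 g ->
    gsem L (term_graph sigma d.+1 s d) V g =
    (so_eval (fun x => g (inl (sigma x))) s = g (inl d))) ->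
  gsem L (gDia [:: inl d] (gAnd (term_graph sigma d.+1 s d) phi)) V f =
  gsem L phi V
    (move [:: inl d] (so_eval (fun x => f (inl (sigma x))) s) f).
Proof.
move=> fd d4 sd clphi graph.
rewrite gDiaE; last first.
  by apply/gclosed_free/gclosed_gAnd => //; apply: gclosed_term_graph.
have E m : gsem L (gAnd (term_graph sigma d.+1 s d) phi) V
      (move [:: inl d] m f) =
    (so_eval (fun x => f (inl (sigma x))) s = m /\
     gsem L phi V (move [:: inl d] m f)).
  have [_ fm fd1] := move_fresh m fd d4.
  by rewrite gAndE graph // so_eval_move // fm.
apply/propext; split=> [[m]|h]; first by rewrite E => -[->].
by eexists; rewrite E.
Qed.

Lemma term_graphE sigma d s p V f :
  fresh d f -> (forall x, 4 < sigma x < d) -> 4 < p < d ->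
  gsem L (term_graph sigma d s p) V f =
  (so_eval (fun x => f (inl (sigma x))) s = f (inl p)).
Proof.
move=> + + /andP[p4].
elim: s d p p4 V f => [x|||s1 IH1 s2 IH2|s1 IH1 s2 IH2] d p p4 V f fd sd pd.
- by rewrite gEq_inl.
- by rewrite gEq_inl (proj1 fd 0).
- rewrite gNextE gEq_inl /incr_pos /= (proj1 fd 0) //.
  by rewrite inlE (_ : (p == 0) = false) ?addn0 //; lia.
all: have d4 : 4 < d by lia.
all: have sd' x : sigma x < d by case/andP: (sd x).
all: set e1 := so_eval (fun x => f (inl (sigma x))) s1.
all: set e2 := so_eval (fun x => f (inl (sigma x))) s2.
all: have [lo1 eq1 fd1] := move_fresh e1 fd d4.
all: have d14 : 4 < d.+1 by lia.
all: have [lo2 eq2 fd2] := move_fresh e2 fd1 d14.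
all: have sd1 x : 4 < sigma x < d.+1 by have := sd x; lia.
all: have sd2 x : 4 < sigma x < d.+2 by have := sd x; lia.
all: have sd1' x : sigma x < d.+1 by have := sd x; lia.
all: rewrite [term_graph _ _ _ _]/= gDia_graph //;
  [|by apply/gclosed_gDia/gclosed_gAnd => //; apply: gclosed_term_graph
   |by move=> g fg; apply: IH1; rewrite ?ltnS; lia || exact: fg || exact: sd1].
all: rewrite gDia_graph // -/e1;
  [|by move=> g fg; apply: IH2; rewrite ?ltnS; lia || exact: fg || exact: sd2].
all: rewrite so_eval_move // -/e2.
- rewrite gPlusE; first (by rewrite lo2 // eq1 eq2 lo2 ?lo1 //; lia).
  + by rewrite /= !inE; lia.
  + by rewrite (proj1 fd2).
- rewrite gTimesE; try lia; first (by rewrite lo2 // eq1 eq2 lo2 ?lo1 //; lia).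
  by move=> q q5; rewrite (proj1 fd2) // q5.
Qed.

Lemma gLtE p q V f : p != q -> gsem L (gLt p q) V f = (f (inl p) < f (inl q)).
Proof.
move=> pq; rewrite gNextE gDiaE //; apply/propext.
have E m : gsem L (gEq (inl p) (inl q)) V
    (move [:: inl p] m (incr_pos (inl p) f)) = (f (inl p) + m.+1 = f (inl q)).
  rewrite gEq_inl /move /incr_pos /= !inlE eqxx (negPf pq) [q == p]eq_sym (negPf pq).
  by apply/propext; split; lia.
split=> [[m]|h]; first by rewrite E; lia.
by exists (f (inl q) - (f (inl p)).+1); rewrite E; lia.
Qed.

Lemma gInE p X V f : 1 < p -> f (inl 1) = 0 -> f (inr X) = 0 ->
  gsem L (gIn p X) V f = L (inr X) (f (inl p)).
Proof.
move=> p1 f1 fX; rewrite gDiaE //; apply/propext.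
have E m : gsem L (gAnd (gEq (inl 1) (inl p)) (GBit (inr X))) V
    (move [:: inl 1; inr X] m f) = (m = f (inl p) /\ L (inr X) m).
  rewrite gAndE gEq_inl /gsem /move /= f1 fX !eqxx !inlE.
  have -> : (1 == p) = false by lia.
  rewrite !add0n !addn0 !muln0 !muln1 addn0.
  by [].
split=> [[m]|h]; first by rewrite E => -[->].
by exists (f (inl p)); rewrite E.
Qed.

Lemma translateE sigma d phi V f :
  fresh d f -> 4 < d -> (forall x, 4 < sigma x < d) ->
  gsem L (translate sigma d phi) V f <->
  fsat (fun x => f (inl (sigma x))) (sets_of L) phi.
Proof.
elim: phi sigma d V f => [s1 s2|s1 s2|s X|phi IH|phi1 IH1 phi2 IH2|
  phi1 IH1 phi2 IH2|z phi IH|z phi IH] sigma d V f fd d4 sd; rewrite [fsat _ _ _]/=.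
all: have sd' x : sigma x < d by case/andP: (sd x).
all: have sd1 x : 4 < sigma x < d.+1 by have := sd x; lia.
all: have d14 : 4 < d.+1 by lia.
all: have graph1 u V' g : fresh d.+1 g ->
    gsem L (term_graph sigma d.+1 u d) V' g =
    (so_eval (fun x => g (inl (sigma x))) u = g (inl d))
  by move=> fg; apply: term_graphE => //; lia.
all: have clg d' u p := gclosed_term_graph sigma d' u p.
all: rewrite [translate _ _ _]/=.
- rewrite gDia_graph //; last by move=> g; apply: graph1.
  have [lo1 eq1 fd1] := move_fresh (so_eval (fun x => f (inl (sigma x))) s1) fd d4.
  by rewrite graph1 // so_eval_move // eq1; split=> ->.
- rewrite gDia_graph //; last 2 first.
  + by apply/gclosed_gDia/gclosed_gAnd.
  + by move=> g; apply: graph1.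
  have [lo1 eq1 fd1] := move_fresh (so_eval (fun x => f (inl (sigma x))) s1) fd d4.
  rewrite gDia_graph //; last 2 first.
  + by move=> x; have := sd' x; lia.
  + by move=> g fg; apply: term_graphE => // [x|]; [have := sd x|]; lia.
  rewrite so_eval_move //.
  have [lo2 eq2 fd2] := move_fresh (so_eval (fun x => f (inl (sigma x))) s2) fd1 d14.
  by rewrite gLtE ?(lo2 d) ?eq1 ?eq2 //; lia.
- rewrite gDia_graph //; last by move=> g; apply: graph1.
  have [lo1 eq1 fd1] := move_fresh (so_eval (fun x => f (inl (sigma x))) s) fd d4.
  by rewrite gInE ?eq1 ?(proj1 fd1) ?(proj2 fd1) //; lia.
- by rewrite gNegE IH.
- by rewrite gAndE IH1 // IH2.
- by rewrite gImpE IH1 // IH2.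
all: have upd m : (fun y => move [:: inl d] m f (inl ([eta sigma with z |-> d] y))) =
    [eta (fun x => f (inl (sigma x))) with z |-> m]
  by have [lo1 eq1 _] := move_fresh m fd d4; apply/funext => y /=;
     case: eqP => // _; rewrite lo1.
all: have E m : gsem L (translate [eta sigma with z |-> d] d.+1 phi) V
      (move [:: inl d] m f) <->
    fsat [eta (fun x => f (inl (sigma x))) with z |-> m] (sets_of L) phi
  by rewrite -upd; apply: IH => //;
    [case: (move_fresh m fd d4)|move=> y /=; case: eqP => // _; lia].
- rewrite gDiaE; last exact/gclosed_free/gclosed_translate.
  by split=> -[m /E h]; exists m.
- rewrite gBoxE; last exact/gclosed_free/gclosed_translate.
  by split=> h m; apply/E.
Qed.

(* The coordinates 5 and 6 hold the two arguments of the relation [psi], and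
   coordinate 13 holds its parameter. *)
Definition gAcc (psi : gform) :=
  GMu 1 (gBox [:: inl 6] (gImp psi
    (gBox [:: inl 5] (gImp (gEq (inl 5) (inl 6)) (GPred 1))))).

Definition pos (x u v : nat) : gpos := fun c =>
  if c == inl 5 then u else if c == inl 6 then v else if c == inl 13 then x else 0.

(** One unfolding moves coordinate 6 forward to a related v and then lets coordinate 5 catch up,
    returning to a position with equal arguments. Since coordinates never move back, only steps with
    u <= v are seen. The least fixpoint of this is accessibility. *)
Lemma gAccE psi V x (R : nat -> nat -> Prop) :
  gclosed psi ->
  (forall V' u v, gsem L psi V' (pos x u v) <-> R u v) ->
  forall u, gsem L (gAcc psi) V (pos x u u) <->
            Acc (fun v u => u <= v /\ R u v) u.
Proof.
move=> clpsi psiR.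
have /andP[/nilP frpsi _] := clpsi.
have move6 u v m : move [:: inl 6] m (pos x u v) = pos x u (v + m).
  apply/funext => -[p|X]; rewrite /move /pos /= ?inlE; last by lia.
  case: (p == 13); case: (eqVneq p 5) => [->|?] /=; try lia;
    by case: (eqVneq p 6) => _ /=; lia.
have move5 u v m : move [:: inl 5] m (pos x u v) = pos x (u + m) v.
  apply/funext => -[p|X]; rewrite /move /pos /= ?inlE; last by lia.
  by case: (p == 6); case: (p == 13); case: (eqVneq p 5) => _ /=; lia.
have body xi u : gsem L (gBox [:: inl 6] (gImp psi
      (gBox [:: inl 5] (gImp (gEq (inl 5) (inl 6)) (GPred 1)))))
      [eta V with 1 |-> xi] (pos x u u) <->
    forall v, u <= v /\ R u v -> xi (pos x v v).
  rewrite gBoxE; last by rewrite /= frpsi.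
  split=> [h v [uv Ruv]|h m].
    have := h (v - u); rewrite move6 subnKC // gImpE psiR gBoxE // => /(_ Ruv).
    by move=> /(_ (v - u)); rewrite move5 subnKC // gImpE gEq_inl; apply.
  rewrite move6 gImpE psiR gBoxE // => Rum k; rewrite move5 gImpE gEq_inl gPredE.
  by rewrite {1 2}/pos /= => ->; apply: h; split=> //; apply: leq_addr.
move=> u; rewrite /gAcc gMuE; split=> [h|].
  pose xi f := forall u', f = pos x u' u' -> Acc (fun v u => u <= v /\ R u v) u'.
  refine (h xi _ u erefl) => g + u' eg; rewrite {}eg => hg.
  by apply: Acc_intro => v uv; apply: (iffLR (body _ _) hg v uv).
move=> acc_u xi hxi; elim: acc_u => {}u _ IH; apply/hxi/body => v uv.
exact: IH.
Qed.

End NumberCoordinates.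

Lemma gclosed_gAcc psi : gclosed psi -> gclosed (gAcc psi).
Proof.
move=> /andP[/nilP frpsi wfpsi].
apply/andP; split; first by rewrite /= frpsi.
by rewrite /= wfpsi !gocc_notin ?frpsi.
Qed.

(* The variables 0 and 1 are the arguments of a binary relation, and 8 is the
   input. *)
Definition env (x u v : nat) : nat -> nat := fun i =>
  if i == 0 then u else if i == 1 then v else if i == 8 then x else 0.

(** The successor v comes first, so that accessibility of u excludes infinite chains of successors
    from u. *)
Definition wf_step (x : nat) (eta : nat -> set nat) (E : fo) (v u : nat) : Prop :=
  u <= v /\ fsat (env x u v) eta E.

(* The variables 0, 1 and 8 are mapped to the coordinates 5, 6 and 13 of [pos], and
   those from 9 on to coordinate 14, which stays 0. *)
Definition wf_sentence (A E : fo) : gform :=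
  let tr := translate (fun i => minn i 9 + 5) 15 in
  gAnd gAperiodic (gAnd (tr A) (gAcc (tr E))).

Lemma gclosed_wf_sentence A E : gclosed (wf_sentence A E).
Proof.
apply/gclosed_gAnd/gclosed_gAnd/gclosed_gAcc => //; exact: gclosed_translate.
Qed.

Lemma wf_sentenceE L t A E V x : (forall p, L (inl p) = t) ->
  gsem L (wf_sentence A E) V (pos x 0 0) <->
  [/\ aperiodic t, fsat (env x 0 0) (sets_of L) A
    & Acc (wf_step x (sets_of L) E) 0].
Proof.
move=> Lt.
have tr u v phi V' : aperiodic t ->
    gsem L (translate (fun i => minn i 9 + 5) 15 phi) V' (pos x u v) <->
    fsat (env x u v) (sets_of L) phi.
  move=> ap; rewrite (translateE Lt ap) => //; last by move=> i; lia.
    rewrite (_ : (fun y => _) = env x u v) //; apply/funext => i.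
    by do 10 case: i => [//|i].
  by split=> // q; rewrite /pos !inlE; do 3 case: eqP => [->//|_].
have clE := gclosed_translate (fun i => minn i 9 + 5) 15 E.
have trA := tr 0 0 A V; have trE V' u v := tr u v E V'.
rewrite /wf_sentence; move: clE trA trE.
move: (translate _ _ A) (translate _ _ E) => psiA psiE clE trA trE.
rewrite gAndE gAndE (gAperiodicE Lt); [|by []..].
have acc (ap : aperiodic t) := gAccE Lt ap V clE (fun V' u v => trE V' u v ap) 0.
split=> [[ap [hA hE]]|[ap hA hE]].
  exact: And3 ap (iffLR (trA ap) hA) (iffLR (acc ap) hE).
exact: conj ap (conj (iffRL (trA ap) hA) (iffRL (acc ap) hE)).
Qed.

(** * The reduction *)

(** Evaluated at position 0, [gEq] compares whole traces, so this makes the first n number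
    coordinates carry the same trace. *)
Fixpoint gBase (n : nat) : gform :=
  if n is n'.+1 then gAnd (gEq (inl 0) (inl n')) (gBase n')
  else gEq (inl 0) (inl 0).

Lemma gclosed_gBase n : gclosed (gBase n).
Proof. by elim: n => [|n IH] //=; apply: gclosed_gAnd. Qed.

Lemma gBaseE L V n :
  gsem L (gBase n) V (fun=> 0) <-> forall p, p < n -> L (inl p) = L (inl 0).
Proof.
have E p : gsem L (gEq (inl 0) (inl p)) V (fun=> 0) <-> L (inl p) = L (inl 0).
  rewrite gEqE; case: p => [|p]; first by split.
  have mv m : (move [:: inl 0; inl p.+1] m (fun=> 0) (inl 0) = m) *
              (move [:: inl 0; inl p.+1] m (fun=> 0) (inl p.+1) = m).
    by rewrite /move /= eqxx; split; lia.
  split=> [h|-> m]; last by rewrite !mv.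
  by apply/funext => m; have := h m; rewrite !mv.
elim: n => [|n IH]; rewrite [gBase _]/=; first by rewrite E; split.
rewrite gAndE E IH; split=> [[Ln h] p|h].
  by rewrite ltnS leq_eqVlt => /orP[/eqP->|/h].
by split=> [|p pn]; apply: h => //; apply: ltnW.
Qed.

(* Moving coordinate 13 x times is the only use of the input x. *)
Definition reduct_matrix (A E : fo) (n x : nat) : gform :=
  gAnd (gBase n) (iter x (GNext (inl 13)) (wf_sentence A E)).

Lemma gclosed_reduct_matrix A E n x : gclosed (reduct_matrix A E n x).
Proof.
apply: gclosed_gAnd; first exact: gclosed_gBase.
by elim: x => [|x IH] /=; first exact: gclosed_wf_sentence.
Qed.

Definition core_bound (A E : fo) : nat :=
  maxn (cindex (inl 13)) (gsize (wf_sentence A E)).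

(** Path indices interleave numbers and sets, so [gBase] reaches indices up to twice [core_bound].
    Neither bound depends on the input, hence neither does the number of path variables. *)
Definition path_bound (A E : fo) : nat :=
  maxn (core_bound A E) (gsize (gBase (core_bound A E).+1)).

Lemma reduct_size A E x :
  gsize (iter x (GNext (inl 13)) (wf_sentence A E)) <= core_bound A E.
Proof.
elim: x => [|x IH] /=; first exact: leq_maxr.
by rewrite geq_max IH andbT; apply: leq_maxl.
Qed.

Lemma reduct_matrix_size A E x :
  gsize (reduct_matrix A E (core_bound A E).+1 x) <= path_bound A E.
Proof.
rewrite /reduct_matrix [gsize _]/= geq_max leq_maxr andTb.
by apply: leq_trans (reduct_size A E x) _; apply: leq_maxl.
Qed.

Lemma gsem_iter_next L x phi V f :
  gsem L (iter x (GNext (inl 13)) phi) V f =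
  gsem L phi V (fun c => f c + x * (c == inl 13)).
Proof.
elim: x f => [|x IH] f; rewrite [iter _ _ _]/=.
  by congr gsem; apply/funext => c; lia.
rewrite gNextE IH; congr gsem; apply/funext => c.
by rewrite /incr_pos; case: eqP => _ /=; lia.
Qed.

Lemma reduct_matrixE A E x L V t :
  let n := (core_bound A E).+1 in
  (forall p, p < n -> L (inl p) = t) ->
  gsem L (reduct_matrix A E n x) V (fun=> 0) <->
  [/\ aperiodic t, fsat (env x 0 0) (sets_of L) A
    & Acc (wf_step x (sets_of L) E) 0].
Proof.
move=> n Lt.
(* Number coordinates beyond the bound may carry other traces; [L'] puts [t] there as well, which
   the sentence cannot detect. *)
pose L' c := if c is inl _ then t else L c.
have LL' c : cindex c <= core_bound A E -> L c = L' c.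
  by case: c => [p|X] //= pb; apply: Lt; lia.
have -> : sets_of L = sets_of L' by [].
rewrite -(@wf_sentenceE L' t A E V x) // /reduct_matrix gAndE.
rewrite (gsem_eq_le V LL' (reduct_size A E x)) gsem_iter_next.
have -> : (fun c => 0 + x * (c == inl 13)) = pos x 0 0.
  apply/funext => -[p|X]; rewrite /pos /= ?inlE; last by lia.
  case: (eqVneq p 5) => [->|_] /=; first by lia.
  case: (eqVneq p 6) => [->|_] /=; first by lia.
  by case: (p == 13) => /=; lia.
split=> [[]//|h]; split=> //; apply/gBaseE => p pn.
by rewrite !Lt.
Qed.

Definition squares (m : nat) : bool := [exists i : 'I_m.+1, m == i * i].

Lemma squaresP m : reflect (exists i, m = i * i) (squares m).
Proof.
apply: (iffP existsP) => [[i /eqP]|[i mi]]; first by exists i.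
have im : i < m.+1 by nia.
by exists (Ordinal im); apply/eqP.
Qed.

(* b^2 + (b - a) lies strictly between b^2 and (b + 1)^2 when a < b. *)
Lemma aperiodic_squares : aperiodic squares.
Proof.
suff lt a b : a < b -> ~ forall m, squares (a + m) = squares (b + m).
  move=> a b h; case: (ltngtP a b) => // /lt []//.
move=> ab h.
have sq : squares (a + (b * b - a)) by apply/squaresP; exists b; nia.
move: sq; rewrite h => /squaresP[i hi].
have : b < i by nia.
nia.
Qed.

Definition reduct (AP : finType) (a : AP) (A E : fo) (x : nat) : formula AP :=
  existT _ (path_bound A E).+1
    (ex_closure (qform_of a (path_bound A E)
      (reduct_matrix A E (core_bound A E).+1 x))).

Lemma satisfiable_reduct (AP : finType) (a : AP) (A E : fo) (x : nat) :
  satisfiable (reduct a A E x) <->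
  exists eta, fsat (env x 0 0) eta A /\ Acc (wf_step x eta E) 0.
Proof.
pose N := path_bound A E; pose n := (core_bound A E).+1.
have zero : gpos_of ([ffun=> 0] : position N.+1) = fun=> 0.
  by apply/funext => c; rewrite /gpos_of ffunE; case: ifP.
have phiN := reduct_matrix_size A E x; split.
  case=> T [_ /models_ex_closure[t [V hV]]].
  pose L c m := a \in val (t (inord (cindex c))) m.
  (* The given valuation at the assignment [t], carried over to [gpos] and false outside the image
     of [gpos_of]. *)
  pose V0 X f := exists2 j, f = gpos_of j & V X (fun p => Some (t p)) j.
  have VV0 X j : V X (fun p => Some (t p)) j <-> V0 X (gpos_of j).
    by split=> [h|[j' /gpos_of_inj->]]; first exists j.
  move: hV; rewrite (@qsem_qform_of AP a N T t L _ _ V0 V phiN) // zero => hV.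
  have Ln p : p < n -> L (inl p) = L (inl 0).
    by move: p; apply/(gBaseE L V0 n); move: hV; rewrite gAndE => -[].
  move: hV; rewrite (reduct_matrixE x V0 Ln) => -[_ hA hE].
  by exists (sets_of L).
(* All path quantifiers are existential, so the set of all traces supplies whatever traces are
   needed. *)
case=> eta [hA hE]; exists setT; split; first by exists (fun=> finset.set0).
pose L (c : coord) m := if c is inr X then `[<eta X m>] else squares m.
pose tr p : trace AP := fun m =>
  if L (if odd p then inr p./2 else inl p./2) m then [set a]%SET else finset.set0.
pose t (p : 'I_N.+1) : [set: trace AP]%classic := exist _ (tr p) (mem_set I).
apply/models_ex_closure; exists t; pose V X Pi (j : position N.+1) := False.
exists (fun X Pi => (fun=> False) : set (position N.+1)).
apply/(@qsem_qform_of AP a N _ t L N _ (fun _ _ => False) _ phiN) => //.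
  move=> c m cN; rewrite /t /= /tr inordK //.
  have -> : (if odd (cindex c) then inr (cindex c)./2 else inl (cindex c)./2) = c.
    by case: c {cN} => k /=; rewrite ?odd_double /= ?doubleK ?uphalf_double.
  by case: ifP => _; rewrite ?finset.inE ?eqxx.
have etaE : sets_of L = eta.
  by apply/funext => X; apply/funext => m; rewrite /sets_of /= asboolE.
rewrite -etaE in hA hE; rewrite zero.
exact: iffRL (@reduct_matrixE A E x L _ squares (fun _ _ => erefl))
  (And3 aperiodic_squares hA hE).
Qed.

Lemma pair_code_ge a z : z <= pair_code a z.
Proof. exact: leq_addr. Qed.

Lemma pair_codeS_gt a z : z < pair_code a.+1 z.
Proof.
by rewrite /pair_code /= !plusE addnS /=; lia.
Qed.

Lemma hcode_ex_closure (AP : finType) N (psi : qform AP N.+1) :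
  hcode (ex_closure psi) = foldr (fun (p : 'I_N.+1) c => pair_code 0 (pair_code p c))
    (pair_code 2 (qcode psi)) (enum 'I_N.+1).
Proof. by rewrite /ex_closure; elim: (enum _) => //= p s ->. Qed.

Lemma qcode_iter_next (AP : finType) (a : AP) N phi x :
  qcode (qform_of a N (iter x (GNext (inl 13)) phi)) =
  iter x (fun z => pair_code 2 (pair_code (inord 26 : 'I_N.+1) z))
    (qcode (qform_of a N phi)).
Proof. by elim: x => //= x ->. Qed.

Lemma computable_reduct (AP : finType) (a : AP) A E :
  computable (fun x => code (reduct a A E x)).
Proof.
apply: computable_pair_code; rewrite /=.
under eq_fun do rewrite hcode_ex_closure.
elim: (enum _) => [|p s IH] /=; last by do 2 apply: computable_pair_code.
(* Five pairings lead to the part depending on x: one for the body, and four for [gAnd], which is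
   spelled with negations and a disjunction. *)
do 2 apply: computable_pair_code; apply: computable_pair_code.
apply: computable_pair_code; apply: computable_pair_code.
under eq_fun do rewrite qcode_iter_next.
exact: computable_iter_pair_code.
Qed.

(** Every next operator strictly increases the code, so the number of them can be recovered. *)
Lemma code_reduct_inj (AP : finType) (a : AP) A E :
  injective (fun x => code (reduct a A E x)).
Proof.
move=> x y /= /pair_code_inj[_]; rewrite !hcode_ex_closure.
elim: (enum _) => [|p s IH] /=; last by move=> /pair_code_inj[_ /pair_code_inj[_ /IH]].
do 5 move=> /pair_code_inj[_]; rewrite !qcode_iter_next.
set g := fun z => _; set c := qcode _.
have g_gt z : z < g z by apply: leq_ltn_trans (pair_code_ge _ z) (pair_codeS_gt _ _).
have it_lt u v : u < v -> iter u g c < iter v g c.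
  elim: v => // v IH; rewrite ltnS leq_eqVlt => /orP[/eqP->|/IH lt]; first exact: g_gt.
  exact: ltn_trans lt (g_gt _).
by case: (ltngtP x y) => // /it_lt; [move=> + e|move=> + e]; rewrite e ltnn.
Qed.

Lemma one_reducible_wf (AP : finType) (a : AP) A E (S : set nat) :
  (forall x, S x <->
     exists eta, fsat (env x 0 0) eta A /\ Acc (wf_step x eta E) 0) ->
  one_reducible S (hmu_sat AP).
Proof.
move=> SP; exists (fun x => code (reduct a A E x)); split.
- exact: computable_reduct.
- exact: code_reduct_inj.
move=> x; rewrite SP -(satisfiable_reduct a); split=> [sat|[phi [/code_inj<- //]]].
have /andP[/nilP cl wf_x] :=
  gclosed_reduct_matrix A E (core_bound A E).+1 x.
exists (reduct a A E x); split=> //.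
  by rewrite wf_ex_closure qwf_qform_of.
by rewrite hclosed_ex_closure // free_preds_qform_of.
Qed.

(** * Sigma^1_2 sets and well-founded trees *)

(** A block of universal set quantifiers over the names in U amounts to a single quantifier over
    valuations that may differ on U only. *)
Lemma Pi11_matrix psi : Pi11 psi ->
  exists theta (U : seq nat), arithmetical theta /\
    forall rho eta, so_sat rho eta psi <->
      forall eta', (forall Z, Z \notin U -> eta' Z = eta Z) ->
        so_sat rho eta' theta.
Proof.
have base theta : arithmetical theta ->
    exists theta' (U : seq nat), arithmetical theta' /\
    forall rho eta, so_sat rho eta theta <->
      forall eta', (forall Z, Z \notin U -> eta' Z = eta Z) ->
        so_sat rho eta' theta'.
  move=> ar; exists theta, [::]; split=> // rho eta.
  split=> [h eta' e|]; last by apply.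
  by rewrite (_ : eta' = eta) //; apply/funext => Z; apply: e.
elim: psi => [s t|s t|s X|psi _|psi1 _ psi2 _|x psi _|x psi _|X psi _|X psi IH];
  try by [|move=> h; apply: (base _ h)].
move=> /IH[theta [U [ar thetaP]]]; exists theta, (X :: U); split=> // rho eta.
split=> [h eta' e|h S].
  apply: (iffLR (thetaP _ _) (h (eta' X))) => Z ZU /=.
  by case: eqP => [->//|/eqP ZX]; apply: e; rewrite inE negb_or ZX.
apply/thetaP => eta' e; apply: h => Z; rewrite inE negb_or => /andP[ZX ZU].
by rewrite e //= (negPf ZX).
Qed.

Definition input (x : nat) : nat -> nat := fun i => if i == 0 then x else 0.

(** Truth of the defining formula does not depend on the set valuation, so its existential block can
    be traded for a choice of the whole valuation. *)
Lemma Sigma12_set_matrix A : Sigma12_set A ->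
  exists theta (U : seq nat), arithmetical theta /\
    forall x, A x <-> exists eta, forall eta',
      (forall Z, Z \notin U -> eta' Z = eta Z) -> so_sat (input x) eta' theta.
Proof.
case=> psi psiS psiP.
have [psi1 [psi1P le1 le2]] : exists psi1, [/\ Pi11 psi1,
    forall rho eta, so_sat rho eta psi -> exists eta', so_sat rho eta' psi1 &
    forall rho eta, so_sat rho eta psi1 -> so_sat rho eta psi].
  have base chi : Pi11 chi -> exists psi1, [/\ Pi11 psi1,
      forall rho eta, so_sat rho eta chi -> exists eta', so_sat rho eta' psi1 &
      forall rho eta, so_sat rho eta psi1 -> so_sat rho eta chi].
    by exists chi; split=> // rho eta; exists eta.
  elim: psi psiS {psiP} => [s t|s t|s X|psi _|phi1 _ phi2 _|x psi _|x psi _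
      |X psi IH|X psi _]; try by move=> h; apply: (base _ h).
  move=> /IH[psi1 [p1 le1 le2]]; exists psi1; split=> //.
    by move=> rho eta [S /le1].
  move=> rho eta /le2 h; exists (eta X).
  have e : (fun Z => if Z == X then eta X else eta Z) = eta.
    by apply/funext => Z; case: eqP => [->|].
  by move: h; rewrite -{1}e.
have [theta [U [ar thetaP]]] := Pi11_matrix psi1P.
exists theta, U; split=> // x; split=> [|[eta /thetaP/le2]].
  rewrite (psiP (input x) (fun=> set0)) => /le1[eta /thetaP h].
  by exists eta.
by rewrite -psiP.
Qed.

(** * Coding the instances of subformulas *)

Fixpoint term_bound (s : so_term) : nat :=
  match s with
  | TVar x => x.+1
  | TZero | TOne => 0
  | TAdd s1 s2 | TMul s1 s2 => maxn (term_bound s1) (term_bound s2)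
  end.

(** Bound variables count as well, so an update at a quantified variable stays among the first K
    values recorded in a code. *)
Fixpoint var_bound (chi : so_form) : nat :=
  match chi with
  | SOEq s t | SOLt s t => maxn (term_bound s) (term_bound t)
  | SOIn s _ => term_bound s
  | SONot a | SOEx2 _ a | SOAll2 _ a => var_bound a
  | SOAnd a b => maxn (var_bound a) (var_bound b)
  | SOEx1 y a | SOAll1 y a => maxn y.+1 (var_bound a)
  end.

Lemma so_eval_ext K r r' s : (forall i, i < K -> r i = r' i) ->
  term_bound s <= K -> so_eval r s = so_eval r' s.
Proof.
move=> e; elim: s => [x|||s1 IH1 s2 IH2|s1 IH1 s2 IH2] //=; first exact: e.
  by rewrite geq_max => /andP[/IH1-> /IH2->].
by rewrite geq_max => /andP[/IH1-> /IH2->].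
Qed.

Lemma so_sat_ext K r r' eta chi : (forall i, i < K -> r i = r' i) ->
  var_bound chi <= K -> so_sat r eta chi = so_sat r' eta chi.
Proof.
have upd y m r1 r2 : (forall i, i < K -> r1 i = r2 i) ->
    forall i, i < K -> [eta r1 with y |-> m] i = [eta r2 with y |-> m] i.
  by move=> e i iK /=; rewrite e.
elim: chi r r' eta => [s t|s t|s X|a IH|a IHa b IHb|y a IH|y a IH|X a IH|X a IH]
  r r' eta e /=.
- by rewrite geq_max => /andP[sK tK]; rewrite !(so_eval_ext e).
- by rewrite geq_max => /andP[sK tK]; rewrite !(so_eval_ext e).
- by move=> sK; rewrite (so_eval_ext e).
- by move=> aK; rewrite (IH r r').
- by rewrite geq_max => /andP[aK bK]; rewrite (IHa r r') // (IHb r r').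
- rewrite geq_max => /andP[_ aK]; apply: eq_exists => m.
  by apply: IH => //; apply: upd.
- rewrite geq_max => /andP[_ aK]; apply: eq_forall => m.
  by apply: IH => //; apply: upd.
- by move=> aK; apply: eq_exists => S; apply: IH.
- by move=> aK; apply: eq_forall => S; apply: IH.
Qed.

Fixpoint term_code (s : so_term) : nat :=
  match s with
  | TVar x => pair_code 0 x
  | TZero => pair_code 1 0
  | TOne => pair_code 2 0
  | TAdd s1 s2 => pair_code 3 (pair_code (term_code s1) (term_code s2))
  | TMul s1 s2 => pair_code 4 (pair_code (term_code s1) (term_code s2))
  end.

Fixpoint form_code (chi : so_form) : nat :=
  match chi with
  | SOEq s t => pair_code 0 (pair_code (term_code s) (term_code t))
  | SOLt s t => pair_code 1 (pair_code (term_code s) (term_code t))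
  | SOIn s X => pair_code 2 (pair_code (term_code s) X)
  | SONot a => pair_code 3 (form_code a)
  | SOAnd a b => pair_code 4 (pair_code (form_code a) (form_code b))
  | SOEx1 y a => pair_code 5 (pair_code y (form_code a))
  | SOAll1 y a => pair_code 6 (pair_code y (form_code a))
  | SOEx2 y a => pair_code 7 (pair_code y (form_code a))
  | SOAll2 y a => pair_code 8 (pair_code y (form_code a))
  end.

Lemma term_code_inj : injective term_code.
Proof.
elim=> [x|||s1 IH1 s2 IH2|s1 IH1 s2 IH2] [y|||t1 t2|t1 t2] //= /pair_code_inj[] //.
- by move=> _ ->.
- by move=> _ /pair_code_inj[/IH1-> /IH2->].
- by move=> _ /pair_code_inj[/IH1-> /IH2->].
Qed.

Lemma form_code_inj : injective form_code.
Proof.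
elim=> [s t|s t|s X|a IH|a IHa b IHb|y a IH|y a IH|X a IH|X a IH]
  [s' t'|s' t'|s' X'|a'|a' b'|y' a'|y' a'|X' a'|X' a'] //= /pair_code_inj[] // _.
- by move=> /pair_code_inj[/term_code_inj-> /term_code_inj->].
- by move=> /pair_code_inj[/term_code_inj-> /term_code_inj->].
- by move=> /pair_code_inj[/term_code_inj-> ->].
- by move=> /IH->.
- by move=> /pair_code_inj[/IHa-> /IHb->].
- by move=> /pair_code_inj[-> /IH->].
- by move=> /pair_code_inj[-> /IH->].
- by move=> /pair_code_inj[-> /IH->].
- by move=> /pair_code_inj[-> /IH->].
Qed.

(* Unlike the Cantor pairing, this injection is the value of a term. *)
Definition poly_pair (m n : nat) : nat := (m + n) * (m + n) + m.

Definition pair_term (s t : so_term) : so_term :=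
  TAdd (TMul (TAdd s t) (TAdd s t)) s.

(** With s = m + n, the code lies between s^2 and s^2 + s, below (s + 1)^2; so it determines s, and
    then m. *)
Lemma poly_pair_inj m n m' n' :
  poly_pair m n = poly_pair m' n' -> m = m' /\ n = n'.
Proof.
rewrite /poly_pair => e.
have : m + n = m' + n'.
  by case: (ltngtP (m + n) (m' + n')) => // lt; exfalso; nia.
by move=> e'; rewrite e' in e; lia.
Qed.

Definition numeral (n : nat) : so_term := iter n (TAdd TOne) TZero.

Lemma so_eval_numeral rho n : so_eval rho (numeral n) = n.
Proof. by elim: n => //= n ->. Qed.

Fixpoint tuple_code (K : nat) (r : nat -> nat) : nat :=
  if K is K'.+1 then poly_pair (r K') (tuple_code K' r) else 0.

Fixpoint tuple_term (K : nat) (ts : nat -> so_term) : so_term :=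
  if K is K'.+1 then pair_term (ts K') (tuple_term K' ts) else TZero.

Lemma so_eval_tuple rho K ts :
  so_eval rho (tuple_term K ts) = tuple_code K (fun i => so_eval rho (ts i)).
Proof. by elim: K => //= K ->. Qed.

Lemma tuple_code_inj K r r' : tuple_code K r = tuple_code K r' ->
  forall i, i < K -> r i = r' i.
Proof.
elim: K => //= K IH /poly_pair_inj[e /IH h] i.
by rewrite ltnS leq_eqVlt => /orP[/eqP->|/h].
Qed.

(** The leading 0, against the 1 in [member_code], keeps instances of formulas apart from membership
    questions. *)
Definition truth_code K chi r : nat :=
  poly_pair 0 (poly_pair (form_code chi) (tuple_code K r)).

Definition truth_term K chi ts : so_term :=
  pair_term TZero (pair_term (numeral (form_code chi)) (tuple_term K ts)).

Definition member_code Z m : nat := poly_pair 1 (poly_pair Z m).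

Definition member_term Z s : so_term :=
  pair_term TOne (pair_term (numeral Z) s).

Lemma so_eval_truth_term rho K chi ts : so_eval rho (truth_term K chi ts) =
  truth_code K chi (fun i => so_eval rho (ts i)).
Proof. by rewrite /= so_eval_numeral so_eval_tuple. Qed.

Definition is_all (chi : so_form) : bool := if chi is SOAll1 _ _ then true else false.

(* The value w attached to an instance of [chi] is a truth value together with a
   witness: for an existential quantifier, 0 is false and v + 1 says that v is a
   witness; for a universal one, 0 is true and v + 1 says that v is a
   counterexample; otherwise only w = 0 (false) or not (true) matters. *)
Definition says (chi : so_form) (w : nat) : Prop :=
  if is_all chi then w = 0 else w <> 0.

Definition is_value (r : nat -> nat) eta chi w : Prop :=
  (says chi w <-> so_sat r eta chi) /\
  match chi with
  | SOEx1 y a => forall v, w = v.+1 -> so_sat [eta r with y |-> v] eta a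
  | SOAll1 y a => forall v, w = v.+1 -> ~ so_sat [eta r with y |-> v] eta a
  | _ => True
  end.

Fixpoint subforms (chi : so_form) : seq so_form :=
  chi :: match chi with
  | SONot a | SOEx1 _ a | SOAll1 _ a => subforms a
  | SOAnd a b => subforms a ++ subforms b
  | _ => [::]
  end.

Lemma In_cat (T : Type) (x : T) s t :
  List.In x (s ++ t) <-> List.In x s \/ List.In x t.
Proof. by elim: s => [|y s IH] /=; [|rewrite IH]; tauto. Qed.

Lemma subforms_bound K chi psi : arithmetical chi -> var_bound chi <= K ->
  List.In psi (subforms chi) -> arithmetical psi /\ var_bound psi <= K.
Proof.
elim: chi => [s t|s t|s X|a IH|a IHa b IHb|y a IH|y a IH|X a IH|X a IH] //= ar.
- by move=> ? [<-|].
- by move=> ? [<-|].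
- by move=> ? [<-|].
- by move=> aK [<-//|h]; apply: IH.
- have /andP[ara arb] := ar; move=> abK.
  have [aK bK] : var_bound a <= K /\ var_bound b <= K by apply/andP; rewrite -geq_max.
  by move=> [<-//|/In_cat[h|h]]; [apply: IHa|apply: IHb].
- move=> yaK; have aK : var_bound a <= K by move: yaK; rewrite geq_max => /andP[].
  by move=> [<-//|h]; apply: IH.
- move=> yaK; have aK : var_bound a <= K by move: yaK; rewrite geq_max => /andP[].
  by move=> [<-//|h]; apply: IH.
Qed.

(** * Local correctness of truth values *)

Section Locally.
Variables (K : nat) (U : seq nat).

(* [H c w] is a finite approximation of the graph of a function giving the values
   of all instances of subformulas and the members of the sets in U. *)
Definition locally (H : nat -> nat -> Prop) (eta : nat -> set nat)
    (r : nat -> nat) (chi : so_form) : Prop :=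
  let T psi r' := H (truth_code K psi r') in
  match chi with
  | SOEq _ _ | SOLt _ _ =>
      forall w, T chi r w -> (w <> 0 <-> so_sat r eta chi)
  | SOIn s Z =>
      if Z \in U then
        forall w w1, T chi r w -> H (member_code Z (so_eval r s)) w1 ->
          (w <> 0 <-> w1 <> 0)
      else forall w, T chi r w -> (w <> 0 <-> so_sat r eta chi)
  | SONot a => forall w w1, T chi r w -> T a r w1 -> (w <> 0 <-> ~ says a w1)
  | SOAnd a b => forall w w1 w2, T chi r w -> T a r w1 -> T b r w2 ->
      (w <> 0 <-> says a w1 /\ says b w2)
  | SOEx1 y a => forall w w1 v, T chi r w -> T a [eta r with y |-> v] w1 ->
      (w = 0 -> ~ says a w1) /\ (w = v.+1 -> says a w1)
  | SOAll1 y a => forall w w1 v, T chi r w -> T a [eta r with y |-> v] w1 ->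
      (w = 0 -> says a w1) /\ (w = v.+1 -> ~ says a w1)
  | _ => True
  end.

Definition agree_from (r r' : nat -> nat) := forall i, K <= i -> r i = r' i.

(** The first condition makes the values describe a counterexample to [theta]; the second inspects
    all instances that keep the variables from K on. *)
Definition consistent theta H eta r :=
  (forall w, H (truth_code K theta r) w -> ~ says theta w) /\
  forall psi, List.In psi (subforms theta) ->
    forall r', agree_from r' r -> locally H eta r' psi.

Definition with_members (h : nat -> nat) (eta : nat -> set nat) : nat -> set nat :=
  fun Z => if Z \in U then (fun m => h (member_code Z m) <> 0) else eta Z.

(** Each local condition involves at most three values of [h], so it is visible in a sufficiently
    long initial segment. Induction on [chi] turns these conditions into truth, with the sets in U
    read off [h]. *)
Lemma locally_truth (h : nat -> nat) eta r0 chi :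
  arithmetical chi -> var_bound chi <= K ->
  (forall n psi, List.In psi (subforms chi) -> forall r, agree_from r r0 ->
     locally (fun c w => c <= n /\ w = h c) eta r psi) ->
  forall r, agree_from r r0 ->
    says chi (h (truth_code K chi r)) <-> so_sat r (with_members h eta) chi.
Proof.
(* The sum of the codes involved serves as the length of the initial segment. *)
have lts a b c : [/\ a <= a + b + c, b <= a + b + c & c <= a + b + c].
  by split; lia.
elim: chi => [s t|s t|s Z|a IH|a IHa b IHb|y a IH|y a IH|X a IH|X a IH] //= ar bK loc
  r rr0.
- by apply: (loc _ _ (or_introl erefl) r rr0).
- by apply: (loc _ _ (or_introl erefl) r rr0).
- rewrite /with_members /=; have := loc
    (truth_code K (SOIn s Z) r + member_code Z (so_eval r s) + 0)
    _ (or_introl erefl) r rr0 => /=.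
  have [l1 l2 _] := lts (truth_code K (SOIn s Z) r) (member_code Z (so_eval r s)) 0.
  by case: ifP => ZU; [apply|apply].
- have [l1 l2 _] := lts (truth_code K (SONot a) r) (truth_code K a r) 0.
  have := loc _ _ (or_introl erefl) r rr0 _ _ (conj l1 erefl) (conj l2 erefl).
  by rewrite (IH ar bK _ r rr0) // => n psi ha; apply: loc; right.
- have [l1 l2 l3] := lts (truth_code K (SOAnd a b) r) (truth_code K a r)
    (truth_code K b r).
  have := loc _ _ (or_introl erefl) r rr0 _ _ _ (conj l1 erefl) (conj l2 erefl)
    (conj l3 erefl).
  have /andP[ara arb] := ar.
  have /andP[aK bK'] : (var_bound a <= K) && (var_bound b <= K) by rewrite -geq_max.
  rewrite (IHa ara aK (fun n psi psia => loc n psi (or_intror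
    (iffRL (In_cat _ _ _) (or_introl psia)))) r rr0).
  by rewrite (IHb arb bK' (fun n psi psib => loc n psi (or_intror
    (iffRL (In_cat _ _ _) (or_intror psib)))) r rr0).
- have /andP[yK aK] : (y < K) && (var_bound a <= K) by rewrite -geq_max.
  have rv v : agree_from [eta r with y |-> v] r0.
    by move=> i iK /=; case: eqP => [iy|_]; [lia|apply: rr0].
  have IHv v := IH ar aK (fun n psi ha => loc n psi (or_intror ha)) _ (rv v).
  have E v : (h (truth_code K (SOEx1 y a) r) = 0 ->
       ~ so_sat [eta r with y |-> v] (with_members h eta) a) /\
     (h (truth_code K (SOEx1 y a) r) = v.+1 ->
       so_sat [eta r with y |-> v] (with_members h eta) a).
    have [l1 l2 _] := lts (truth_code K (SOEx1 y a) r)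
      (truth_code K a [eta r with y |-> v]) 0.
    rewrite -IHv; exact: (loc _ _ (or_introl erefl) r rr0 _ _ v
      (conj l1 erefl) (conj l2 erefl)).
  rewrite /says /=; split=> [|[v hv] /(proj1 (E v))]; last exact.
  by case e : (h _) => [|v] // _; exists v; apply: (proj2 (E v)).
- have /andP[yK aK] : (y < K) && (var_bound a <= K) by rewrite -geq_max.
  have rv v : agree_from [eta r with y |-> v] r0.
    by move=> i iK /=; case: eqP => [iy|_]; [lia|apply: rr0].
  have IHv v := IH ar aK (fun n psi ha => loc n psi (or_intror ha)) _ (rv v).
  have E v : (h (truth_code K (SOAll1 y a) r) = 0 ->
       so_sat [eta r with y |-> v] (with_members h eta) a) /\
     (h (truth_code K (SOAll1 y a) r) = v.+1 ->
       ~ so_sat [eta r with y |-> v] (with_members h eta) a).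
    have [l1 l2 _] := lts (truth_code K (SOAll1 y a) r)
      (truth_code K a [eta r with y |-> v]) 0.
    rewrite -IHv; exact: (loc _ _ (or_introl erefl) r rr0 _ _ v
      (conj l1 erefl) (conj l2 erefl)).
  rewrite /says /=; split=> [e v|hv]; first exact: (proj1 (E v)).
  by case e : (h _) => [|v] //; have := proj2 (E v) e (hv v).
Qed.

Lemma is_value_ext r r' eta chi w : (forall i, i < K -> r i = r' i) ->
  var_bound chi <= K -> is_value r eta chi w = is_value r' eta chi w.
Proof.
move=> e bK; rewrite /is_value (so_sat_ext eta e bK); congr (_ /\ _).
have upd y a v : maxn y.+1 (var_bound a) <= K ->
    so_sat [eta r with y |-> v] eta a = so_sat [eta r' with y |-> v] eta a.
  rewrite geq_max => /andP[_ aK].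
  by apply: (so_sat_ext eta _ aK) => i iK /=; rewrite e.
by case: chi bK => // y a /upd bK; apply: eq_forall => v; rewrite bK.
Qed.

Lemma is_value_exists r eta chi : exists w, is_value r eta chi w.
Proof.
have simple (P : Prop) : exists w : nat, w <> 0 <-> P.
  by have [p|np] := pselect P; [exists 1|exists 0]; split.
have [w0] := simple (so_sat r eta chi).
case: chi => [s t|s t|s Z|a|a b|y a|y a|X a|X a] hw0; try by exists w0; split.
- have [[v hv]|no] := pselect (so_sat r eta (SOEx1 y a)).
    by exists v.+1; split=> [|v' [<-]] //; split=> // _; exists v.
  by exists 0; split=> //; split.
- have [all|no] := pselect (so_sat r eta (SOAll1 y a)).
    by exists 0; split=> //; split.
  have [v hv] : exists v, ~ so_sat [eta r with y |-> v] eta a.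
    by apply: contrapT => h; apply: no => v; apply: contrapT => hv; apply: h; exists v.
  by exists v.+1; split=> [|v' [<-]] //; split.
Qed.

(** A code determines the formula and the first K values, hence by [is_value_ext] which values are
    admissible; so one can be chosen code by code, with 0 at numbers that are no codes. *)
Lemma value_function eta : exists h : nat -> nat,
  (forall chi r, var_bound chi <= K -> is_value r eta chi (h (truth_code K chi r))) /\
  (forall Z m, h (member_code Z m) <> 0 <-> eta Z m).
Proof.
have /choice[h hP] : forall c, exists w,
    (forall chi r, var_bound chi <= K -> c = truth_code K chi r ->
       is_value r eta chi w) /\
    (forall Z m, c = member_code Z m -> (w <> 0 <-> eta Z m)).
  move=> c.
  have [[chi [r [bK ->]]]|notT] :=
      pselect (exists chi r, var_bound chi <= K /\ c = truth_code K chi r).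
    have [w hw] := is_value_exists r eta chi; exists w.
    split=> [chi' r' bK'|Z m] /poly_pair_inj[] // _ /poly_pair_inj[].
    move=> /form_code_inj e; rewrite -{}e => /tuple_code_inj e.
    by rewrite -(is_value_ext _ _ e).
  have [[Z [m ->]]|notM] := pselect (exists Z m, c = member_code Z m).
    have [p|np] := pselect (eta Z m); [exists 1|exists 0]; split=> [chi r|Z' m'];
      by move=> ? /poly_pair_inj[] || move=> /poly_pair_inj[_ /poly_pair_inj[<- <-]].
  exists 0; split=> [chi r bK e|Z m e]; exfalso; first by apply: notT; exists chi, r.
  by apply: notM; exists Z, m.
exists h; split=> [chi r bK|Z m]; first exact: (proj1 (hP _)).
exact: (proj2 (hP _)).
Qed.

(** Counterpart of [locally_truth]: entries taken from a correct value function violate no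
    condition, however many are present. *)
Lemma value_locally h eta eta' (H : nat -> nat -> Prop) r chi :
  (forall chi r, var_bound chi <= K -> is_value r eta' chi (h (truth_code K chi r))) ->
  (forall Z m, h (member_code Z m) <> 0 <-> eta' Z m) ->
  (forall Z, Z \notin U -> eta' Z = eta Z) ->
  (forall c w, H c w -> w = h c) ->
  arithmetical chi -> var_bound chi <= K -> locally H eta r chi.
Proof.
move=> hv hm agr Hh.
case: chi => [s t|s t|s Z|a|a b|y a|y a|X a|X a] // ar bK; rewrite /locally.
- by move=> w /Hh->; apply: (proj1 (hv (SOEq s t) r bK)).
- by move=> w /Hh->; apply: (proj1 (hv (SOLt s t) r bK)).
- case: ifP => ZU; [move=> w w1 /Hh-> /Hh->|move=> w /Hh->].
    by rewrite hm; apply: (proj1 (hv (SOIn s Z) r bK)).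
  by rewrite /= -agr ?ZU //; apply: (proj1 (hv (SOIn s Z) r bK)).
- move=> w w1 /Hh-> /Hh->; rewrite (proj1 (hv a r bK)).
  exact: (proj1 (hv (SONot a) r bK)).
- have /andP[aK bK'] : (var_bound a <= K) && (var_bound b <= K) by rewrite -geq_max.
  move=> w w1 w2 /Hh-> /Hh-> /Hh->; rewrite (proj1 (hv a r aK)) (proj1 (hv b r bK')).
  exact: (proj1 (hv (SOAnd a b) r bK)).
- have /andP[_ aK] : (y < K) && (var_bound a <= K) by rewrite -geq_max.
  move=> w w1 v /Hh-> /Hh->; rewrite (proj1 (hv a _ aK)).
  have [h1 h2] := hv (SOEx1 y a) r bK; split=> [e hs|/h2//].
  by apply: (iffRL h1 (ex_intro _ v hs)).
- have /andP[_ aK] : (y < K) && (var_bound a <= K) by rewrite -geq_max.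
  move=> w w1 v /Hh-> /Hh->; rewrite (proj1 (hv a _ aK)).
  have [h1 h2] := hv (SOAll1 y a) r bK; split=> [e|/h2//].
  exact: (iffLR h1 e v).
Qed.

End Locally.

(* Set 0 encodes that the sequence u has the entry w at index c, and set 1 that it
   has length d; the set variable X of the matrix becomes X + 2, and its number
   variable x becomes 8 + x. *)
Definition Val (y : nat) (c w : so_term) : fo :=
  FIn (pair_term (TVar y) (pair_term c w)) 0.

Definition Dep (s d : so_term) : fo := FIn (pair_term s d) 1.

Definition value_at (eta : nat -> set nat) (u c w : nat) : Prop :=
  eta 0 (poly_pair u (poly_pair c w)).

Definition dep (eta : nat -> set nat) (u d : nat) : Prop := eta 1 (poly_pair u d).

Definition FIff phi psi := FAnd (FImp phi psi) (FImp psi phi).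

Definition nonzero (x : nat) : fo := FNot (FEq (TVar x) TZero).

Definition says_fo (chi : so_form) (x : nat) : fo :=
  if is_all chi then FEq (TVar x) TZero else nonzero x.

Lemma says_foE rho eta chi x : fsat rho eta (says_fo chi x) = says chi (rho x).
Proof. by rewrite /says_fo /says; case: is_all. Qed.

Fixpoint shift (s : so_term) : so_term :=
  match s with
  | TVar x => TVar (8 + x)
  | TZero => TZero
  | TOne => TOne
  | TAdd s1 s2 => TAdd (shift s1) (shift s2)
  | TMul s1 s2 => TMul (shift s1) (shift s2)
  end.

Lemma so_eval_shift rho s : so_eval rho (shift s) = so_eval (fun i => rho (8 + i)) s.
Proof. by elim: s => //= s1 -> s2 ->. Qed.

(** * Tree and edges as first-order formulas *)

Section LocalFormulas.
Variables (K : nat) (U : seq nat).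

Definition svar (i : nat) : so_term := TVar (8 + i).

Definition has_value (chi : so_form) (ts : nat -> so_term) (x : nat) (phi : fo) :=
  FImp (Val 1 (truth_term K chi ts) (TVar x)) phi.

(** Variable 1 is the node whose entries are read; 5 and 6 hold w and w1, and 7 holds w2 or the
    number v put in for a quantified variable. *)
Definition locally_fo (chi : so_form) : fo :=
  match chi with
  | SOEq s t => FAll 5 (has_value chi svar 5
      (FIff (nonzero 5) (FEq (shift s) (shift t))))
  | SOLt s t => FAll 5 (has_value chi svar 5
      (FIff (nonzero 5) (FLt (shift s) (shift t))))
  | SOIn s Z =>
      if Z \in U then FAll 5 (FAll 6 (has_value chi svar 5
        (FImp (Val 1 (member_term Z (shift s)) (TVar 6))
          (FIff (nonzero 5) (nonzero 6)))))
      else FAll 5 (has_value chi svar 5 (FIff (nonzero 5) (FIn (shift s) Z.+2)))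
  | SONot a => FAll 5 (FAll 6 (has_value chi svar 5 (has_value a svar 6
      (FIff (nonzero 5) (FNot (says_fo a 6))))))
  | SOAnd a b => FAll 5 (FAll 6 (FAll 7 (has_value chi svar 5
      (has_value a svar 6 (has_value b svar 7
        (FIff (nonzero 5) (FAnd (says_fo a 6) (says_fo b 7))))))))
  | SOEx1 y a => FAll 5 (FAll 6 (FAll 7 (has_value chi svar 5
      (has_value a [eta svar with y |-> TVar 7] 6
        (FAnd (FImp (FEq (TVar 5) TZero) (FNot (says_fo a 6)))
          (FImp (FEq (TVar 5) (TAdd (TVar 7) TOne)) (says_fo a 6)))))))
  | SOAll1 y a => FAll 5 (FAll 6 (FAll 7 (has_value chi svar 5
      (has_value a [eta svar with y |-> TVar 7] 6
        (FAnd (FImp (FEq (TVar 5) TZero) (says_fo a 6))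
          (FImp (FEq (TVar 5) (TAdd (TVar 7) TOne)) (FNot (says_fo a 6))))))))
  | _ => FEq TZero TZero
  end.

Lemma has_valueE rho eta chi ts x phi :
  fsat rho eta (has_value chi ts x phi) =
  (value_at eta (rho 1) (truth_code K chi (fun i => so_eval rho (ts i))) (rho x) ->
   fsat rho eta phi).
Proof. by rewrite -so_eval_truth_term. Qed.

#[local] Opaque has_value.

Lemma locally_foE rho eta chi : fsat rho eta (locally_fo chi) <->
  locally K U (value_at eta (rho 1)) (fun Z => eta Z.+2) (fun i => rho (8 + i)) chi.
Proof.
have quant y v rho' : rho' 7 = v -> (forall i, rho' (8 + i) = rho (8 + i)) ->
    (fun i => so_eval rho' ([eta svar with y |-> TVar 7] i)) =
    [eta (fun i => rho (8 + i)) with y |-> v].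
  by move=> e7 e; apply/funext => i /=; case: eqP => _ //=; apply: e.
have succ (w v : nat) : (w = v + 1) = (w = v.+1) by rewrite addn1.
case: chi => [s t|s t|s Z|a|a b|y a|y a|X a|X a]; rewrite /locally /locally_fo //.
- rewrite [fsat _ _ _]/=; split=> h w; have := h w;
    by rewrite has_valueE /FIff /= !so_eval_shift.
- rewrite [fsat _ _ _]/=; split=> h w; have := h w;
    by rewrite has_valueE /FIff /= !so_eval_shift.
- case: ifP => ZU; rewrite [fsat _ _ _]/=; split=> h w;
    [move=> w1; have := h w w1|move=> w1; have := h w w1|have := h w|have := h w];
    by rewrite has_valueE /FIff /= ?so_eval_numeral !so_eval_shift.
- by rewrite [fsat _ _ _]/=; split=> h w w1; have := h w w1;
    rewrite !has_valueE /FIff /= ?says_foE.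
- by rewrite [fsat _ _ _]/=; split=> h w w1 w2; have := h w w1 w2;
    rewrite !has_valueE /FIff /= ?says_foE.
- by rewrite [fsat _ _ _]/=; split=> h w w1 v; have := h w w1 v;
    rewrite !has_valueE (quant y v) //= ?says_foE succ.
- by rewrite [fsat _ _ _]/=; split=> h w w1 v; have := h w w1 v;
    rewrite !has_valueE (quant y v) //= ?says_foE succ.
Qed.

Fixpoint FAllK (k : nat) (phi : fo) : fo :=
  if k is k'.+1 then FAll (8 + k') (FAllK k' phi) else phi.

Lemma FAllKE k rho eta phi : fsat rho eta (FAllK k phi) <->
  forall rho', (forall i, (i < 8) || (8 + k <= i) -> rho' i = rho i) ->
    fsat rho' eta phi.
Proof.
elim: k rho => [|k IH] rho.
  split=> [h rho' e|]; last by apply.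
  rewrite (_ : rho' = rho) //; apply/funext => i; apply: e; lia.
split=> [h rho' e|h m].
  apply: (iffLR (IH [eta rho with 8 + k |-> rho' (8 + k)]) (h _)) => i hi.
  rewrite [RHS]/=; case: eqP => [->//|ne]; apply: e; lia.
apply/IH => rho' e; apply: h => i hi; rewrite e; last by lia.
by rewrite /=; case: eqP => // ei; lia.
Qed.

Definition consistent_fo (theta : so_form) : fo :=
  FAnd (FAll 5 (has_value theta svar 5 (FNot (says_fo theta 5))))
    (FAllK K (foldr (fun psi phi => FAnd (locally_fo psi) phi) (FEq TZero TZero)
      (subforms theta))).

Lemma consistent_foE rho eta theta : fsat rho eta (consistent_fo theta) <->
  consistent K U theta (value_at eta (rho 1)) (fun Z => eta Z.+2) (fun i => rho (8 + i)).
Proof.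
have allE rho' : fsat rho' eta (foldr (fun psi phi => FAnd (locally_fo psi) phi)
      (FEq TZero TZero) (subforms theta)) <->
    forall psi, List.In psi (subforms theta) -> fsat rho' eta (locally_fo psi).
  elim: (subforms theta) => [|psi s IH] /=; first by split.
  rewrite IH; split=> [[h1 h2] chi [<-|/h2]|h] //.
  by split=> [|chi hchi]; apply: h; [left|right].
rewrite [fsat _ _ _]/= FAllKE; split=> -[h1 h2]; split.
- by move=> w; have := h1 w; rewrite has_valueE /= says_foE.
- move=> psi psi_in r' r'E.
  pose rho' i := if i < 8 then rho i else r' (i - 8).
  have := iffLR (allE rho') (h2 rho' _) _ psi_in.
  rewrite locally_foE (_ : (fun i => rho' (8 + i)) = r'); last first.
    by apply/funext => i; rewrite /rho' ltnNge leq_addr /= addKn.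
  apply=> i; rewrite /rho'; case: ifP => //= i8 iK.
  rewrite r'E; last by lia.
  by congr rho; lia.
- by move=> w; have := h1 w; rewrite has_valueE /= says_foE.
- move=> rho' e; apply/allE => psi psi_in; apply/locally_foE.
  rewrite e //; apply: h2 => // i iK.
  by apply: e; lia.
Qed.

End LocalFormulas.

(* The node 1 extends the node 0, of length 2, by the entry 3. *)
Definition step_fo : fo :=
  FAnd (Dep (TVar 0) (TVar 2)) (FAnd (Dep (TVar 1) (TAdd (TVar 2) TOne))
    (FAll 4 (FAll 5 (FIff (Val 1 (TVar 4) (TVar 5))
      (FImp (FNot (Val 0 (TVar 4) (TVar 5)))
        (FAnd (FEq (TVar 4) (TVar 2)) (FEq (TVar 5) (TVar 3)))))))).

Definition child eta (u v d a : nat) : Prop :=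
  [/\ dep eta u d, dep eta v d.+1 &
    forall c w, value_at eta v c w <-> value_at eta u c w \/ (c = d /\ w = a)].

Lemma step_foE rho eta : fsat rho eta step_fo <->
  child eta (rho 0) (rho 1) (rho 2) (rho 3).
Proof.
(* [fo] has no disjunction; [step_fo] writes it as an implication from a negation. *)
have orE (P Q : Prop) : (~ P -> Q) <-> P \/ Q.
  by split=> [h|[p /(_ p)//|q _]//]; have [p|/h] := pselect P; [left|right].
rewrite /= addn1; split=> [[h1 [h2 h]]|[h1 h2 h]].
  split=> // c w; have [h3 h4] := h c w.
  by split=> [/h3/orE|/orE/h4].
split=> //; split=> // c w; have [h3 h4] := h c w.
by split=> [/h3/orE|/orE/h4].
Qed.

Definition tree_fo : fo :=
  FAnd (Dep TZero TZero) (FAnd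
    (FAll 4 (FAll 5 (FNot (FIn (pair_term TZero (pair_term (TVar 4) (TVar 5))) 0))))
    (FAll 0 (FAll 2 (FAll 3 (FImp (Dep (TVar 0) (TVar 2))
      (FEx 1 (FAnd (FLt (TVar 0) (TAdd (TVar 1) TOne)) step_fo))))))).

(** Only the existence of children is demanded, so further nodes do no harm. The bound u <= v is
    there because [wf_step] sees no other edges. *)
Definition full_tree eta : Prop :=
  [/\ dep eta 0 0, forall c w, ~ value_at eta 0 c w &
    forall u d a, dep eta u d -> exists2 v, u <= v & child eta u v d a].

Lemma tree_foE rho eta : fsat rho eta tree_fo <-> full_tree eta.
Proof.
rewrite /tree_fo; split=> [[h1 [h2 h3]]|[h1 h2 h3]].
  split=> // u d a /(h3 u d a)[v [uv /step_foE hv]].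
  by exists v => //; move: uv; rewrite /= addn1.
split=> //; split=> // u d a /(h3 u d a)[v uv hv].
exists v; split; first by rewrite /= addn1.
by apply: (iffRL (step_foE _ _)).
Qed.

Definition edge_fo (K : nat) (U : seq nat) (theta : so_form) : fo :=
  FAnd (FEx 2 (FEx 3 step_fo)) (consistent_fo K U theta).

Lemma edge_foE K U theta x u v eta : fsat (env x u v) eta (edge_fo K U theta) <->
  (exists d a, child eta u v d a) /\
  consistent K U theta (value_at eta v) (fun Z => eta Z.+2) (input x).
Proof.
split=> -[[d [a h1]] h2].
  by split; [exists d, a; apply: (iffLR (step_foE _ _) h1)|
             apply: (iffLR (consistent_foE _ _ _ _ _) h2)].
by split; [exists d, a; apply: (iffRL (step_foE _ _) h1)|
           apply: (iffRL (consistent_foE _ _ _ _ _) h2)].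
Qed.

(** * The tree of finite sequences *)

Fixpoint seq_code (s : seq nat) : nat :=
  if s is v :: s' then (poly_pair v (seq_code s')).+1 else 0.

Lemma seq_code_inj : injective seq_code.
Proof. by elim=> [|v s IH] [|w s'] //= [] /poly_pair_inj[-> /IH->]. Qed.

Lemma seq_code_cons v s : seq_code s <= seq_code (v :: s).
Proof. by rewrite /= /poly_pair; nia. Qed.

(* A node is a finite sequence, stored in reverse. *)
Definition tree_sets (eta : nat -> set nat) : nat -> set nat := fun Z =>
  match Z with
  | 0 => fun k => exists s i, i < size s /\
           k = poly_pair (seq_code s) (poly_pair i (nth 0 (rev s) i))
  | 1 => fun k => exists s, k = poly_pair (seq_code s) (size s)
  | Z'.+2 => eta Z'
  end.

Lemma val_tree_sets eta s c w :
  value_at (tree_sets eta) (seq_code s) c w <-> c < size s /\ w = nth 0 (rev s) c.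
Proof.
split=> [[s' [i [i_lt]]]|[cs ->]]; last by exists s, c.
by move=> /poly_pair_inj[/seq_code_inj-> /poly_pair_inj[-> ->]].
Qed.

Lemma dep_tree_sets eta u d :
  dep (tree_sets eta) u d <-> exists2 s, u = seq_code s & d = size s.
Proof.
split=> [[s /poly_pair_inj[-> ->]]|[s -> ->]]; last by exists s.
by exists s.
Qed.

Lemma full_tree_sets eta : full_tree (tree_sets eta).
Proof.
split=> [|c w|u d a /dep_tree_sets[s -> ->]].
- by apply/dep_tree_sets; exists [::].
- by move=> /(val_tree_sets eta [::]) [].
exists (seq_code (a :: s)); first exact: seq_code_cons.
split=> [||c w]; [by apply/dep_tree_sets; exists s|
  by apply/dep_tree_sets; exists (a :: s)|].
rewrite !val_tree_sets rev_cons nth_rcons size_rev /= ltnS leq_eqVlt.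
case: (ltngtP c (size s)) => [cs|cs|->] /=.
- by split=> [|[//|[e _]]]; [left|rewrite e ltnn in cs].
- by split=> [[]|[[]|[e _]]] //; rewrite e ltnn in cs.
- by split=> [[_ ->]|[[]|[_ ->]]] //; right.
Qed.

(** An inaccessible element has an inaccessible [R]-predecessor, and iterating a choice of these
    gives a chain. *)
Lemma Acc_no_chain (R : nat -> nat -> Prop) a :
  (forall f, f 0 = a -> (forall n, R (f n.+1) (f n)) -> False) -> Acc R a.
Proof.
move=> no_chain; apply: contrapT => na.
have /choice[next nextP] : forall u, exists v, ~ Acc R u -> R v u /\ ~ Acc R v.
  move=> u; have [acc|nacc] := pselect (Acc R u); first by exists 0.
  have [v [Rvu nv]] : exists v, R v u /\ ~ Acc R v.
    apply: contrapT => none; apply: nacc; apply: Acc_intro => v Rvu.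
    by apply: contrapT => nv; apply: none; exists v.
  by exists v.
have nf n : ~ Acc R (iter n next a) by elim: n => //= n /nextP[].
by apply: (no_chain (fun n => iter n next a)) => // n; case: (nextP _ (nf n)).
Qed.

Lemma graph_below_succ (h : nat -> nat) n c w :
  (c < n /\ w = h c) \/ (c = n /\ w = h n) <-> c < n.+1 /\ w = h c.
Proof.
rewrite ltnS [c <= n]leq_eqVlt; case: eqP => [->|cn] /=.
  by split=> [[[_ ->]|[_ ->]]|[_ ->]]; [split|split|right].
by split=> [[[cn' ->]|[/cn]]|[cn' ->]]; [split|case|left].
Qed.

(** A counterexample [eta'] has a value function h. Its initial segments pass every test, so
    following them through the tree never ends, against accessibility of the root. *)
Lemma theta_of_wf_tree x U theta eta :
  arithmetical theta -> full_tree eta ->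
  Acc (wf_step x eta (edge_fo (var_bound theta) U theta)) 0 ->
  forall eta', (forall Z, Z \notin U -> eta' Z = eta Z.+2) ->
    so_sat (input x) eta' theta.
Proof.
move=> ar [dep0 val0 ext] acc0 eta' agr; apply: contrapT => nsat.
have [h [hv hm]] := value_function (var_bound theta) eta'.
have noway u : Acc (wf_step x eta (edge_fo (var_bound theta) U theta)) u ->
    forall n, dep eta u n -> (forall c w, value_at eta u c w <-> c < n /\ w = h c) ->
    False.
  elim=> {}u _ IH n dep_u val_u.
  have [v uv chi] := ext u n (h n) dep_u.
  have val_v c w : value_at eta v c w <-> c < n.+1 /\ w = h c.
    by have [_ _ ->] := chi; rewrite val_u; apply: graph_below_succ.
  apply: (IH v _ n.+1) => //; last by have [] := chi.
  split=> //; apply/edge_foE; split; first by exists n, (h n).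
  split=> [w /val_v[_ ->]|psi psi_in r' _].
    by rewrite (proj1 (hv theta (input x) (leqnn _))).
  have [arp bp] := subforms_bound ar (leqnn _) psi_in.
  apply: (@value_locally (var_bound theta) U h (fun Z => eta Z.+2) eta'
    (value_at eta v) r' psi hv hm agr _ arp bp).
  by move=> c w /val_v[].
apply: (noway 0 acc0 0 dep0) => c w.
by split=> [/val0|[]].
Qed.

(** The nodes of an infinite chain are the initial segments of one function h. As all of them are
    consistent, [locally_truth] makes [theta] false for the sets read off h. *)
Lemma wf_tree_of_theta x U theta eta :
  arithmetical theta ->
  (forall eta', (forall Z, Z \notin U -> eta' Z = eta Z) ->
    so_sat (input x) eta' theta) ->
  Acc (wf_step x (tree_sets eta) (edge_fo (var_bound theta) U theta)) 0.
Proof.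
move=> ar sat_theta; apply: Acc_no_chain => f f0 fE.
pose T := tree_sets eta; pose K := var_bound theta.
have /choice[h hP] : forall n, exists a, exists d, child T (f n) (f n.+1) d a.
  by move=> n; have [_ /edge_foE[[d [a hda]] _]] := fE n; exists a, d.
have consis n : consistent K U theta (value_at T (f n.+1)) eta (input x).
  by have [_ /edge_foE[]] := fE n.
(* In [tree_sets] a node has only one length, so the n-th node of the chain has length n. *)
have dep_fun u d d' : dep T u d -> dep T u d' -> d = d'.
  by move=> /dep_tree_sets[s -> ->] /dep_tree_sets[s' /seq_code_inj-> ->].
have f_dep n : dep T (f n) n.
  elim: n => [|n IH]; first by rewrite f0; case: (full_tree_sets eta).
  by have [d [dn dn1 _]] := hP n; rewrite -(dep_fun _ _ _ IH dn) in dn1.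
have f_val n c w : value_at T (f n) c w <-> c < n /\ w = h c.
  elim: n c w => [|n IH] c w.
    rewrite f0; split=> [|[]//]; case: (full_tree_sets eta) => _ val0 _.
    by move=> /val0.
  have [d [dn _ ->]] := hP n; rewrite -(dep_fun _ _ _ (f_dep n) dn) IH.
  exact: graph_below_succ.
have valE n : value_at T (f n.+1) = fun c w => c <= n /\ w = h c.
  by apply/funext => c; apply/funext => w; apply/propext; apply: f_val.
(* This node is just long enough to have an entry at the code of [theta] itself. *)
have root := proj1 (consis (truth_code K theta (input x))).
apply: (root (h (truth_code K theta (input x)))); first by rewrite valE.
rewrite (@locally_truth K U h eta (input x) theta) //.
- by apply: sat_theta => Z ZU; rewrite /with_members (negPf ZU).
- by move=> n psi psi_in r rE; rewrite -valE; apply: (proj2 (consis n)).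
Qed.

Theorem theorem5p4 (AP : finType) (AP_gt0 : 0 < #|AP|) : Sigma12_hard (hmu_sat AP).
Proof.
move=> A /Sigma12_set_matrix[theta [U [ar thetaP]]].
(* One proposition suffices, since each trace has to carry only one sequence of bits. *)
have /card_gt0P[a _] := AP_gt0.
apply: (one_reducible_wf a (A := tree_fo)
  (E := edge_fo (var_bound theta) U theta)) => x.
rewrite thetaP; split=> [[eta sat_theta]|[eta [/tree_foE full acc]]].
  exists (tree_sets eta); split; last exact: wf_tree_of_theta.
  by apply/tree_foE; apply: full_tree_sets.
by exists (fun Z => eta Z.+2); apply: theta_of_wf_tree.
Qed.
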